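(* Let $f$ be a partial Boolean function on $n$ bits and let $t\ge 1$. Then \[\textnormal{R}(f\circ\textnormal{GapMaj}_t)=O\big(t\cdot\textnormal{noisyR}(f)+n\big).\]
   Context: A partial Boolean function $h:\{0,1\}^n\to\{0,1,*\}$ has domain $\textnormal{Dom}(h)=h^{-1}(\{0,1\})$. For partial $f$ on $n$ bits and partial $g$ on $m$ bits, $f\circ g(x_1,\dots,x_n)=f(g(x_1),\dots,g(x_n))$, with output $*$ if some $x_i\notin\textnormal{Dom}(g)$ or $(g(x_1),\dots,g(x_n))\notin\textnormal{Dom}(f)$. $\textnormal{R}(h)$ is bounded-error (error $\le 1/3$ on every input in $\textnormal{Dom}(h)$) randomized query complexity with worst-case number of queries. $\textnormal{GapMaj}_t:\{0,1\}^t\to\{0,1,*\}$ outputs $1$ if $|x|=t/2+2\sqrt t$, $0$ if $|x|=t/2-2\sqrt t$, $*$ otherwise. Noisy oracle: for a bit $b$, a query with parameter $\gamma\in[-1,1]$ returns an independent bit $b'$ with $\Pr[b'=b]=(1+\gamma)/2$ at cost $\gamma^2$; noisy oracle access to $x$ means one such oracle per bit. $\textnormal{noisyR}(h)$ is the minimum, over randomized algorithms with noisy oracle access that are correct with probability $\ge 2/3$ on every $x\in\textnormal{Dom}(h)$, of the maximum over $x\in\textnormal{Dom}(h)$ of the total cost of noisy oracle calls on $x$. The constant in $O(\cdot)$ is absolute (independent of $f$, $n$, $t$). *)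

(* Defs.v *)
From HB Require Import structures.
From mathcomp Require Import all_boot all_order all_algebra.
From mathcomp Require Import all_classical all_reals all_analysis.

Set Implicit Arguments.
Unset Strict Implicit.
Unset Printing Implicit Defensive.

Import Order.TTheory GRing.Theory Num.Theory.

Local Open Scope ring_scope.

(** The input bits are indexed by an arbitrary finite type [I] ('I_n for a
    function on n bits); composing f, indexed by [I], with g, indexed by [J],
    gives a function indexed by [I * J]. The value * is [None]. *)
Definition pboolfun (I : finType) := {ffun I -> bool} -> option bool.

Definition pboolfun_comp (I J : finType) (f : pboolfun I) (g : pboolfun J) :
    pboolfun (I * J)%type :=
  fun x =>
    let y (i : I) := g [ffun j => x (i, j)] in
    if [forall i, isSome (y i)] then f [ffun i => odflt false (y i)] else None.

Definition GapMaj (R : realType) (t : nat) : pboolfun 'I_t :=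
  fun x =>
    let w : R := #|[set j | x j]|%:R in
    if w == t%:R / 2 + 2 * Num.sqrt t%:R then Some true
    else if w == t%:R / 2 - 2 * Num.sqrt t%:R then Some false
    else None.
Arguments GapMaj : clear implicits.

(** Randomized algorithms are finitely supported distributions over
    deterministic ones. This is no restriction, even for noisy algorithms:
    only the success probabilities and expected costs on the finitely many
    inputs matter, and the mean of a random vector in a finite-dimensional
    space lies in the convex hull of its range. *)
Record findist (R : realType) (T : Type) := FinDist {
  fd_size : nat;
  fd_weight : 'I_fd_size -> R;
  fd_elt : 'I_fd_size -> T;
  fd_weight_ge0 : forall j, 0 <= fd_weight j;
  fd_weight_sum1 : \sum_j fd_weight j = 1 }.

Section RandomizedQueryComplexity.
Variables (R : realType) (I : finType).

Inductive dtree := DLeaf of bool | DQuery of I & dtree & dtree.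

Fixpoint dt_eval (x : {ffun I -> bool}) (d : dtree) : bool :=
  match d with
  | DLeaf b => b
  | DQuery i d0 d1 => if x i then dt_eval x d1 else dt_eval x d0
  end.

Fixpoint dt_depth (d : dtree) : nat :=
  match d with
  | DLeaf _ => 0%N
  | DQuery _ d0 d1 => (maxn (dt_depth d0) (dt_depth d1)).+1
  end.

Definition rand_error (A : findist R dtree) (x : {ffun I -> bool}) (b : bool)
    : R :=
  \sum_j fd_weight j * (dt_eval x (fd_elt (f := A) j) != b)%:R.

Definition rand_computable (h : pboolfun I) (T : nat) : Prop :=
  exists A : findist R dtree,
    (forall j, (dt_depth (fd_elt (f := A) j) <= T)%N) /\
    (forall x b, h x = Some b -> rand_error A x b <= 1 / 3).

Lemma findist_dirac (T : Type) (d : T) :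
  exists A : findist R T, exists2 j0 : 'I_(fd_size A),
    (forall j, j = j0) & fd_weight j0 = 1 /\ fd_elt j0 = d.
Proof.
have w0 (j : 'I_1) : 0 <= (fun=> 1 : R) j by exact: ler01.
have w1 : \sum_(j < 1) (fun=> 1 : R) j = 1 by rewrite big_ord1.
exists (FinDist (fun=> d) w0 w1), ord0 => //=.
by move=> j; apply: ord1.
Qed.

Lemma rand_computable_exists (h : pboolfun I) :
  exists T, `[< rand_computable h T >].
Proof.
pose upd (r : {ffun I -> bool}) i c := [ffun j => if j == i then c else r j].
pose full := fix full s r := match s with
  | [::] => DLeaf (odflt false (h r))
  | i :: s' => DQuery i (full s' (upd r i false)) (full s' (upd r i true)) end.
have fullE (x : {ffun I -> bool}) s (r : {ffun I -> bool}) : (forall i, i \notin s -> r i = x i) ->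
    dt_eval x (full s r) = odflt false (h x).
  elim: s r => [|i s IH] r Hr /=.
    by congr (odflt _ (h _)); apply/ffunP=> i; exact: Hr.
  by case xi : (x i); apply: IH => j js; rewrite ffunE;
    case: eqVneq => [->//|ji]; apply: Hr; rewrite inE negb_or ji.
pose d := full (enum I) [ffun=> false].
have [A [j0 jE [w1 dE]]] := findist_dirac d.
exists (dt_depth d); apply/asboolP; exists A; split.
  by move=> j; rewrite (jE j) dE.
move=> x b hx; rewrite /rand_error (bigD1 j0) //= big1 ?addr0; last first.
  by move=> j; rewrite (jE j) eqxx.
rewrite w1 mul1r dE fullE; first by rewrite hx /= eqxx divr_ge0.
by move=> i; rewrite mem_enum.
Qed.

Definition Rquery (h : pboolfun I) : nat := ex_minn (rand_computable_exists h).

End RandomizedQueryComplexity.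

Section NoisyQueryComplexity.
Variables (R : realType) (I : finType).
Local Open Scope ereal_scope.

Variant naction := NOutput of bool | NQuery of I & R.

(** A deterministic noisy-oracle algorithm maps the list of the oracle answers
    received so far to its next action. It may make an unbounded number of
    queries. *)
Definition nalgo := seq bool -> naction.

Definition nalgo_valid (A : nalgo) : Prop :=
  forall s i g, A s = NQuery i g -> (-1 <= g <= 1)%R.

Definition nanswer_prob (x : {ffun I -> bool}) (a : naction) (r : bool) : R :=
  match a with
  | NOutput _ => 0
  | NQuery i g => if r == x i then (1 + g) / 2 else (1 - g) / 2
  end%R.

Definition naction_cost (a : naction) : R :=
  match a with NOutput _ => 0 | NQuery _ g => g ^+ 2 end%R.

Definition naction_outputs (b : bool) (a : naction) : bool :=
  match a with NOutput c => c == b | NQuery _ _ => false end.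

(** Probability that, on input [x], the algorithm makes at least [size s]
    queries and that the first [size s] answers are [s]. *)
Definition nreach (A : nalgo) (x : {ffun I -> bool}) (s : seq bool) : R :=
  (\prod_(k < size s) nanswer_prob x (A (take k s)) (nth false s k))%R.

Definition noutput_prob (A : nalgo) (x : {ffun I -> bool}) (b : bool) : \bar R :=
  \sum_(0 <= k <oo) \sum_(s : k.-tuple bool)
    (nreach A x s * (naction_outputs b (A s))%:R)%:E.

(** The total cost on [x] depends on the oracle answers and is measured in
    expectation. A worst-case measure over the answers would be larger, so
    upper bounds in terms of the expected cost hold for it as well. *)
Definition nexpected_cost (A : nalgo) (x : {ffun I -> bool}) : \bar R :=
  \sum_(0 <= k <oo) \sum_(s : k.-tuple bool)
    (nreach A x s * naction_cost (A s))%:E.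

Definition noisy_output_prob (A : findist R nalgo) x b : \bar R :=
  \sum_j (fd_weight j)%:E * noutput_prob (fd_elt (f := A) j) x b.

Definition noisy_expected_cost (A : findist R nalgo) x : \bar R :=
  \sum_j (fd_weight j)%:E * nexpected_cost (fd_elt (f := A) j) x.

Definition noisy_computes (h : pboolfun I) (A : findist R nalgo) : Prop :=
  (forall j, nalgo_valid (fd_elt (f := A) j)) /\
  (forall x b, h x = Some b -> (2 / 3)%:E <= noisy_output_prob A x b).

(** The costs are nonnegative, hence the default value 0. *)
Definition noisy_max_cost (h : pboolfun I) (A : findist R nalgo) : \bar R :=
  \big[maxe/0]_(x | isSome (h x)) noisy_expected_cost A x.

Definition noisyR (h : pboolfun I) : \bar R :=
  ereal_inf [set noisy_max_cost h A | A in noisy_computes h].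

(** In particular [noisyR] is finite: query every bit once, with g = 1. *)
Lemma noisyR_le_card (h : pboolfun I) : noisyR h <= #|I|%:R%:E.
Proof.
pose e := enum I; have sze : size e = #|I| by rewrite /e -cardE.
pose A : nalgo := fun s =>
  if ohead (drop (size s) e) is Some i then NQuery i 1%R
  else NOutput (odflt false (h [ffun i => nth false s (index i e)])).
have A1 s : (#|I| <= size s)%N ->
    A s = NOutput (odflt false (h [ffun i => nth false s (index i e)])).
  by move=> ss; rewrite /A drop_oversize ?sze.
have A2 s i0 : (size s < #|I|)%N -> A s = NQuery (nth i0 e (size s)) 1%R.
  by move=> ss; rewrite /A (drop_nth i0) ?sze.
have Av : nalgo_valid A.
  move=> s i g; rewrite /A; case: (ohead _) => // a [_ <-].
  by rewrite lexx andbT (le_trans _ (@ler01 R)) // lerN10.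
have ans_prob (x : {ffun I -> bool}) s r : (size s < #|I|)%N ->
    nanswer_prob x (A s) r = (r == nth false (map x e) (size s))%:R%R.
  move=> ss; have i0 : I by move: ss; rewrite -sze; case: (e).
  rewrite (A2 _ i0 ss) /= (nth_map i0) ?sze //; case: (r == _) => /=.
    by rewrite -[(1 + 1)%R]/(2%:R)%R divff // pnatr_eq0.
  by rewrite subrr mul0r.
have reachE (x : {ffun I -> bool}) k (s : k.-tuple bool) : (k <= #|I|)%N ->
    nreach A x s = ((s : seq bool) == take k (map x e))%:R%R.
  move=> kI; rewrite /nreach size_tuple.
  have -> : ((s : seq bool) == take k (map x e)) =
      [forall j : 'I_k, nth false s j == nth false (map x e) j].
    apply/eqP/forallP => [-> j|H]; first by rewrite nth_take.
    apply: (@eq_from_nth _ false).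
      by rewrite size_takel size_tuple // size_map sze.
    by move=> j; rewrite size_tuple => jk; rewrite nth_take //;
      exact/eqP/(H (Ordinal jk)).
  have -> : (\prod_(j < k) nanswer_prob x (A (take j s)) (nth false s j) =
      \prod_(j < k) (nth false s j == nth false (map x e) j)%:R)%R.
    apply: eq_bigr => j _; have sj : size (take j s) = j.
      by rewrite size_takel // size_tuple ltnW.
    by rewrite ans_prob sj // (leq_trans (ltn_ord j)).
  case: forallP => [H|H].
    by rewrite big1 // => j _; rewrite H.
  have [j /negbTE Hj] : exists j : 'I_k,
      nth false s j != nth false (map x e) j.
    by apply/existsP; rewrite -negb_forall; apply/forallP.
  by rewrite (bigD1 j) //= Hj mul0r.
have reach_ge0 (x : {ffun I -> bool}) k (s : k.-tuple bool) : (0 <= nreach A x s)%R.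
  apply: prodr_ge0 => j _; case: (ltnP (size (take j s)) #|I|) => H.
    by rewrite ans_prob.
  by rewrite (A1 _ H).
have szx (x : {ffun I -> bool}) k : (k <= #|I|)%N -> size (take k (map x e)) == k.
  by move=> kI; rewrite size_takel // size_map sze.
have cost x : nexpected_cost A x <= #|I|%:R%:E.
  rewrite /nexpected_cost (nneseries_split 0 #|I|); last first.
    move=> k _; apply: sume_ge0 => s _; rewrite lee_fin mulr_ge0 //.
    by case: (A s) => //= _ g; rewrite sqr_ge0.
  rewrite add0n [X in _ + X]eseries0 ?adde0; last first.
    move=> k /= kI _; rewrite big1 // => s _.
    by rewrite A1 ?size_tuple //= mulr0.
  have -> : #|I|%:R%:E = \sum_(k < #|I|) (1%:E : \bar R).
    by rewrite sumEFin sumr_const card_ord.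
  rewrite big_mkord.
  apply: lee_sum => k _; have kI := ltnW (ltn_ord k).
  rewrite (bigD1 (Tuple (szx x k kI))) //= big1 ?adde0; last first.
    move=> s sN; rewrite reachE // -[X in _ == X]/(val (Tuple (szx x k kI))).
    by rewrite (inj_eq val_inj) (negbTE sN) mul0r.
  have i0 : I by exact: enum_val k.
  rewrite -[take k (map x e)]/(val (Tuple (szx x k kI))) reachE // eqxx mul1r.
  by rewrite (A2 _ i0) ?size_tuple //= expr1n.
have [D [j0 jE [w1 dE]]] := findist_dirac R A.
have FD (F : nalgo -> \bar R) :
    \sum_j (fd_weight j)%:E * F (fd_elt (f := D) j) = F A.
  rewrite (bigD1 j0) //= big1 ?adde0; last by move=> j; rewrite (jE j) eqxx.
  by rewrite w1 mul1e dE.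
have DC : noisy_computes h D.
  split=> [j|x b hx]; first by rewrite (jE j) dE.
  rewrite /noisy_output_prob (FD (fun a => noutput_prob a x b)).
  have term_ge0 k (s : k.-tuple bool) :
      0 <= (nreach A x s * (naction_outputs b (A s))%:R)%:E.
    by rewrite lee_fin mulr_ge0.
  apply: (@le_trans _ _ 1).
    by rewrite lee_fin ler_pdivrMr ?ltr0n // mul1r ler_nat.
  apply: le_trans (nneseries_lim_ge #|I|.+1 _); last first.
    by move=> k _ _; apply: sume_ge0.
  rewrite big_nat_recr //=; apply: le_trans (leeDr _ _); last first.
    by apply: sume_ge0 => k _; apply: sume_ge0.
  rewrite (bigD1 (Tuple (szx x _ (leqnn _)))) //=.
  apply: le_trans (leeDl _ _); last by apply: sume_ge0.
  rewrite -[take _ (map x e)]/(val (Tuple (szx x _ (leqnn _)))).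
  rewrite (reachE x #|I|) // eqxx.
  rewrite mul1r A1 /=; last by rewrite (eqP (szx x _ (leqnn _))).
  have -> : [ffun i => nth false (take #|I| (map x e)) (index i e)] = x.
    apply/ffunP => i; rewrite ffunE take_oversize; last by rewrite size_map sze.
    by rewrite (nth_map i) ?nth_index ?index_mem ?mem_enum.
  by rewrite hx /= eqxx.
apply: (@le_trans _ _ (noisy_max_cost h D)).
  by apply: ereal_inf_lbound; exists D.
apply: (big_ind (fun c => c <= #|I|%:R%:E)); first by rewrite lee_fin.
- by move=> a b ha hb; rewrite ge_max ha.
- by move=> x _; rewrite /noisy_expected_cost (FD (fun a => nexpected_cost a x)).
Qed.

End NoisyQueryComplexity.

(* Main.v *)
(* A uniformly random bit of a block x_i is a noisy copy of b = GapMaj(x_i) with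
   parameter g0 = 4 / sqrt t, obtained with one query, and the block reveals b
   with t = 16 / g0^2 queries.  A call with parameter g therefore has to be
   simulated with O(g^2 / g0^2) queries.

   - If |g| > 1/40, query the whole block.
   - If g0/4 <= |g| <= 1/40, run a +-1 walk on O(g^2 / g0^2) random bits of the
     block, stopped at distance O(|g| / g0); its final position gives a bit of
     bias at least |g|.
   - If |g| < g0/4, a single hidden sample h of the block answers many calls.
     Let y be the bias of the posterior of b (for the uniform prior) given the
     answers produced from h.  As long as |y| <= g0 these answers are a
     degradation of h: they can be drawn given h, without knowing b.  When the
     next answer could push y out of [-g0, g0], a new sample is taken and y is
     reset to 0.  The square of y grows in expectation by at most 8 g^2 per call
     and exceeds g0^2 / 4 at every reset, so with the potential 4 y^2 / g0^2 the
     expected number of samples is O(cost / g0^2) plus O(1) per block.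

   Markov's inequality and a majority vote over three runs turn the expected
   number of queries into a worst-case one.  For t <= 16 one queries every bit. *)

Require Import Defs.
From HB Require Import structures.
From mathcomp Require Import all_boot all_order all_algebra.
From mathcomp Require Import all_classical all_reals all_analysis.
From mathcomp Require Import ring lra.

Set Implicit Arguments.
Unset Strict Implicit.
Unset Printing Implicit Defensive.

Import Order.TTheory GRing.Theory Num.Theory.

Local Open Scope ring_scope.

(** * Finitely supported distributions and decision trees *)

Section FiniteDistributions.
Variable R : realType.

Definition fd_mean (T : Type) (A : findist R T) (F : T -> R) : R :=
  \sum_j fd_weight j * F (fd_elt (f := A) j).

(** Distributions are indexed by ordinals; an arbitrary finite index type allows products and
    disjoint unions of index sets. The second clause carries properties of all [e k] over to the
    support. *)
Lemma findist_of (K : finType) (T : Type) (w : K -> R) (e : K -> T) :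
    (forall k, 0 <= w k) -> \sum_k w k = 1 ->
  exists A : findist R T,
    (forall F, fd_mean A F = \sum_k w k * F (e k)) /\
    (forall P : T -> Prop, (forall k, P (e k)) ->
       forall j, P (fd_elt (f := A) j)).
Proof.
move=> w0 w1.
have sumE (G : K -> R) : \sum_(j < #|K|) G (enum_val j) = \sum_k G k.
  by rewrite -big_enum_val.
have v0 (j : 'I_#|K|) : 0 <= w (enum_val j) by [].
have v1 : \sum_j w (@enum_val K K j) = 1 by rewrite sumE.
exists (FinDist (fun j => e (enum_val j)) v0 v1); split=> [F|P Pe j].
  by rewrite /fd_mean /= (sumE (fun k => w k * F (e k))).
exact: Pe.
Qed.

Lemma fd_mean_le (T : Type) (A : findist R T) (F G : T -> R) :
    (forall j, F (fd_elt (f := A) j) <= G (fd_elt (f := A) j)) ->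
  fd_mean A F <= fd_mean A G.
Proof. by move=> FG; apply: ler_sum => j _; rewrite ler_wpM2l ?fd_weight_ge0. Qed.

Lemma fd_meanD (T : Type) (A : findist R T) (F G : T -> R) :
  fd_mean A (fun a => F a + G a) = fd_mean A F + fd_mean A G.
Proof. by rewrite -big_split; apply: eq_bigr => j _; rewrite mulrDr. Qed.

Lemma fd_meanZ (T : Type) (A : findist R T) (r : R) (F : T -> R) :
  fd_mean A (fun a => r * F a) = r * fd_mean A F.
Proof. by rewrite /fd_mean mulr_sumr; apply: eq_bigr => j _; rewrite mulrCA. Qed.

Lemma fd_mean_cst (T : Type) (A : findist R T) (r : R) :
  fd_mean A (fun=> r) = r.
Proof. by rewrite /fd_mean -mulr_suml fd_weight_sum1 mul1r. Qed.

End FiniteDistributions.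

Section DecisionTrees.
Variables (R : realType) (Q : finType).
Implicit Types (x : {ffun Q -> bool}) (d : dtree Q).

Fixpoint dt_count x d : nat :=
  match d with
  | DLeaf _ => 0
  | DQuery i d0 d1 => (if x i then dt_count x d1 else dt_count x d0).+1
  end.

(** The output [false] on cut branches is a default, later charged as an error. *)
Fixpoint dt_trunc (T : nat) d : dtree Q :=
  match d, T with
  | DLeaf b, _ => DLeaf Q b
  | DQuery i d0 d1, 0%N => DLeaf Q false
  | DQuery i d0 d1, T'.+1 => DQuery i (dt_trunc T' d0) (dt_trunc T' d1)
  end.

Lemma dt_trunc_depth T d : (dt_depth (dt_trunc T d) <= T)%N.
Proof.
by elim: d T => [b|i d0 IH0 d1 IH1] [|T] //=; rewrite ltnS geq_max IH0 IH1.
Qed.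

Lemma dt_trunc_eval T d x :
  (dt_count x d <= T)%N -> dt_eval x (dt_trunc T d) = dt_eval x d.
Proof.
elim: d T => [b|i d0 IH0 d1 IH1] [|T] //=.
by rewrite ltnS; case: (x i); [apply: IH1 | apply: IH0].
Qed.

Fixpoint dt_bind d (k : bool -> dtree Q) : dtree Q :=
  match d with
  | DLeaf b => k b
  | DQuery i d0 d1 => DQuery i (dt_bind d0 k) (dt_bind d1 k)
  end.

Lemma dt_bind_eval d k x :
  dt_eval x (dt_bind d k) = dt_eval x (k (dt_eval x d)).
Proof. by elim: d => [b|i d0 IH0 d1 IH1] //=; case: (x i). Qed.

Lemma dt_bind_depth d k T :
    (forall b, (dt_depth (k b) <= T)%N) ->
  (dt_depth (dt_bind d k) <= dt_depth d + T)%N.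
Proof.
move=> kT; elim: d => [b|i d0 IH0 d1 IH1] //=.
rewrite addSn ltnS geq_max (leq_trans IH0) ?leq_add2r ?leq_maxl //.
by rewrite (leq_trans IH1) ?leq_add2r ?leq_maxr.
Qed.

Definition majority (a b c : bool) : bool := if a == b then a else c.

Definition dt_majority d1 d2 d3 : dtree Q :=
  dt_bind d1 (fun a => dt_bind d2 (fun b => dt_bind d3 (fun c =>
    DLeaf Q (majority a b c)))).

Lemma dt_majority_eval d1 d2 d3 x :
  dt_eval x (dt_majority d1 d2 d3) =
  majority (dt_eval x d1) (dt_eval x d2) (dt_eval x d3).
Proof. by rewrite !dt_bind_eval. Qed.

Lemma dt_majority_depth d1 d2 d3 T :
    (dt_depth d1 <= T)%N -> (dt_depth d2 <= T)%N -> (dt_depth d3 <= T)%N ->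
  (dt_depth (dt_majority d1 d2 d3) <= 3 * T)%N.
Proof.
move=> h1 h2 h3; rewrite mulSn mul2n -addnn.
apply: leq_trans (leq_add h1 (leqnn _)); apply: dt_bind_depth => a.
apply: leq_trans (leq_add h2 (leqnn _)); apply: dt_bind_depth => b.
by rewrite -[T]addn0; apply: leq_trans (leq_add h3 (leqnn _)); apply: dt_bind_depth.
Qed.

(** The majority of three independent runs errs with probability [3 p^2 - 2 p^3], which is below 1/3
    for [p <= 38/100]. *)
Lemma rand_computable_majority (h : pboolfun Q) (A : findist R (dtree Q)) T :
    (forall j, (dt_depth (fd_elt (f := A) j) <= T)%N) ->
    (forall x b, h x = Some b -> rand_error A x b <= 38%:R / 100%:R) ->
  rand_computable R h (3 * T).
Proof.
move=> AT Aerr; pose K := 'I_(fd_size A).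
pose w (k : K * K * K) := fd_weight k.1.1 * fd_weight k.1.2 * fd_weight k.2.
pose e (k : K * K * K) :=
  dt_majority (fd_elt k.1.1) (fd_elt k.1.2) (fd_elt k.2).
have split3 (F G H : K -> R) :
    \sum_(k : K * K * K) F k.1.1 * G k.1.2 * H k.2 =
    (\sum_k F k) * (\sum_k G k) * (\sum_k H k).
  rewrite big_distrlr /= pair_big /= big_distrlr /= pair_big /=.
  by apply: eq_bigr => -[[a b] c].
have w0 k : 0 <= w k by rewrite !mulr_ge0 ?fd_weight_ge0.
have w1 : \sum_k w k = 1 by rewrite split3 !fd_weight_sum1 !mulr1.
have [B [BE Belt]] := findist_of e w0 w1.
exists B; split.
  apply: (Belt (fun d => (dt_depth d <= 3 * T)%N)) => k.
  exact: dt_majority_depth.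
move=> x b hx; have := Aerr _ _ hx.
set p := rand_error A x b => p38.
have p0 : 0 <= p by apply: sumr_ge0 => j _; rewrite mulr_ge0 ?fd_weight_ge0.
pose err (k : K) : R := (dt_eval x (fd_elt k) != b)%:R.
have pE : \sum_k fd_weight k * err k = p by [].
have -> : rand_error B x b = 3%:R * p ^+ 2 - 2%:R * p ^+ 3.
  transitivity (fd_mean B (fun d => (dt_eval x d != b)%:R)) => //.
  rewrite BE.
  pose F k := fd_weight (f := A) k * err k.
  transitivity (\sum_(k : K * K * K) (F k.1.1 * F k.1.2 * fd_weight k.2
     + F k.1.1 * fd_weight k.1.2 * F k.2 + fd_weight k.1.1 * F k.1.2 * F k.2
     - 2%:R * (F k.1.1 * F k.1.2 * F k.2))).
    apply: eq_bigr => k _; rewrite /F /w /e dt_majority_eval /err /majority.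
    by case: (dt_eval x (fd_elt k.1.1)); case: (dt_eval x (fd_elt k.1.2));
      case: (dt_eval x (fd_elt k.2)); case: b {hx p p38 p0 err pE F} => /=; ring.
  rewrite !big_split /= sumrN -mulr_sumr !split3 !fd_weight_sum1 /F pE; ring.
set a : R := 38%:R / 100%:R.
have h1 : 0 <= (a - p) * p by rewrite mulr_ge0 ?subr_ge0.
(* tangent line of [p ^+ 3] at [a] *)
have h2 : 0 <= (a - p) ^+ 2 * (p + 2%:R * a).
  by rewrite mulr_ge0 ?sqr_ge0 ?addr_ge0 ?mulr_ge0 ?divr_ge0.
have {}h1 : p ^+ 2 <= a * p by move: h1; rewrite mulrBl subr_ge0 -expr2.
have {}h2 : 3%:R * a ^+ 2 * p - 2%:R * a ^+ 3 <= p ^+ 3.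
  rewrite -subr_ge0; apply: le_trans h2 _.
  by rewrite le_eqVlt; apply/orP; left; apply/eqP; ring.
(* Both bounds are linear in [p]. They give [3 a p - 6 a^2 p + 4 a^3], which increases with [p] and
   is less than 0.324 at [p = a]. *)
move: h1 h2 p38; rewrite /a; lra.
Qed.

End DecisionTrees.

(** * Acceptance probabilities and expected numbers of queries *)

Section Simulation.
Variables (R : realType) (Q : finType).
Local Notation X := {ffun Q -> bool}.

(** A randomized tree enters the sequel only through its acceptance probability [v] and its expected
    number of queries [c]; mixing and querying act on these two functions by exact formulas. *)
Definition realizable (v c : X -> R) : Prop :=
  exists A : findist R (dtree Q), forall x,
    fd_mean A (fun d => (dt_eval x d)%:R) = v x /\
    fd_mean A (fun d => (dt_count x d)%:R) = c x.

Lemma realizable_leaf (b : bool) : realizable (fun=> b%:R) (fun=> 0).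
Proof.
have [A [AE _]] := @findist_of R unit _ (fun=> 1) (fun=> DLeaf Q b)
  (fun=> ler01) (etrans (big_const _ _ _ _)
    (eq_trans (congr1 (fun n => iter n _ _) card_unit) (addr0 1))).
by exists A => x; rewrite !AE /= !big_const card_unit /= !addr0 !mul1r.
Qed.

Lemma realizable_mixture (K : finType) (w : K -> R) (v c : K -> X -> R) :
    (forall k, 0 <= w k) -> \sum_k w k = 1 ->
    (forall k, realizable (v k) (c k)) ->
  realizable (fun x => \sum_k w k * v k x) (fun x => \sum_k w k * c k x).
Proof.
move=> w0 w1 vc; have {vc} [A AE] := choice vc.
pose K' := {k : K & 'I_(fd_size (A k))}.
pose w' (k : K') := w (tag k) * fd_weight (tagged k).
pose e' (k : K') := fd_elt (tagged k).
have sumE (F : dtree Q -> R) :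
    \sum_(k : K') w' k * F (e' k) = \sum_k w k * fd_mean (A k) F.
  under [RHS]eq_bigr do rewrite mulr_sumr.
  rewrite (sig_big_dep (fun=> true) (fun _ _ => true)
    (fun k (j : 'I_(fd_size (A k))) => w k * (fd_weight j * F (fd_elt j)))) /=.
  by apply: eq_bigr => k _; rewrite mulrA.
have w'0 k : 0 <= w' k by rewrite mulr_ge0 ?fd_weight_ge0.
have w'1 : \sum_k w' k = 1.
  transitivity (\sum_k w k * fd_mean (A k) (fun=> 1)).
    by rewrite -(sumE (fun=> 1)); apply: eq_bigr => k _; rewrite mulr1.
  by rewrite -[RHS]w1; apply: eq_bigr => k _; rewrite fd_mean_cst mulr1.
have [B [BE _]] := findist_of e' w'0 w'1.
exists B => x; split; apply: etrans (BE _) (etrans (sumE _) _);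
  by apply: eq_bigr => k _; have [e1 e2] := AE k x; rewrite ?e1 ?e2.
Qed.

Lemma realizable_mix (p : R) (v1 c1 v0 c0 : X -> R) : 0 <= p <= 1 ->
    realizable v1 c1 -> realizable v0 c0 ->
  realizable (fun x => p * v1 x + (1 - p) * v0 x)
             (fun x => p * c1 x + (1 - p) * c0 x).
Proof.
move=> /andP[p0 p1] h1 h0.
pose w (b : bool) := if b then p else 1 - p.
have w0 b : 0 <= w b by case: b; rewrite /w // subr_ge0.
have w1 : \sum_b w b = 1 by rewrite big_bool /= addrC subrK.
have := realizable_mixture (v := fun b => if b then v1 else v0)
  (c := fun b => if b then c1 else c0) w0 w1.
case; first by case.
by move=> A AE; exists A => x; have [-> ->] := AE x; rewrite !big_bool.
Qed.

(** The two continuations are drawn independently before the query; only the marginal of the one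
    that is followed matters. *)
Lemma realizable_query (q : Q) (v1 c1 v0 c0 : X -> R) :
    realizable v1 c1 -> realizable v0 c0 ->
  realizable (fun x => if x q then v1 x else v0 x)
             (fun x => 1 + if x q then c1 x else c0 x).
Proof.
move=> [A1 A1E] [A0 A0E].
pose w (k : 'I_(fd_size A1) * 'I_(fd_size A0)) := fd_weight k.1 * fd_weight k.2.
pose e (k : 'I_(fd_size A1) * 'I_(fd_size A0)) :=
  DQuery q (fd_elt k.2) (fd_elt k.1).
have sumE (F G : dtree Q -> R) :
    \sum_k w k * (F (fd_elt k.1) * G (fd_elt k.2)) = fd_mean A1 F * fd_mean A0 G.
  rewrite big_distrlr /= pair_big /=; apply: eq_bigr => k _.
  by rewrite mulrACA.
have sumE1 (F : dtree Q -> R) : \sum_k w k * F (fd_elt k.1) = fd_mean A1 F.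
  rewrite -[RHS]mulr1 -[X in _ * X](fd_mean_cst A0 1) -sumE.
  by apply: eq_bigr => k _; rewrite mulr1.
have sumE0 (F : dtree Q -> R) : \sum_k w k * F (fd_elt k.2) = fd_mean A0 F.
  rewrite -[RHS]mul1r -[X in X * _](fd_mean_cst A1 1) -sumE.
  by apply: eq_bigr => k _; rewrite mul1r.
have w0 k : 0 <= w k by rewrite mulr_ge0 ?fd_weight_ge0.
have w1 : \sum_k w k = 1.
  by rewrite -[RHS](fd_mean_cst A1 1) -sumE1; apply: eq_bigr => k _; rewrite mulr1.
have [B [BE _]] := findist_of e w0 w1.
exists B => x; have [e1 e1'] := A1E x; have [e0 e0'] := A0E x.
rewrite !BE /=; case: (x q).
  rewrite (sumE1 (fun d => (dt_eval x d)%:R)) e1; split=> //.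
  under eq_bigr do rewrite mulrS mulrDr mulr1.
  by rewrite big_split /= w1 (sumE1 (fun d => (dt_count x d)%:R)) e1'.
rewrite (sumE0 (fun d => (dt_eval x d)%:R)) e0; split=> //.
under eq_bigr do rewrite mulrS mulrDr mulr1.
by rewrite big_split /= w1 (sumE0 (fun d => (dt_count x d)%:R)) e0'.
Qed.

Lemma realizable_query_all (qs : seq Q) (v c : seq bool -> X -> R) :
    (forall r, realizable (v r) (c r)) ->
  realizable (fun x => v [seq x q | q <- qs] x)
             (fun x => (size qs)%:R + c [seq x q | q <- qs] x).
Proof.
elim: qs v c => [|q qs IH] v c vc /=.
  by have [A AE] := vc [::]; exists A => x; rewrite add0r.
have h b := IH (fun r => v (b :: r)) (fun r => c (b :: r)) (fun r => vc (b :: r)).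
have [A AE] := realizable_query q (h true) (h false).
exists A => x; have [-> ->] := AE x; rewrite -natr1 [_ + 1]addrC -addrA.
by case: (x q).
Qed.

(** Cutting every run after [T] queries adds at most [M / (T + 1) <= 1/40] to the error, and
    [1/3 + 1/100 + 1/40 < 38/100]. *)
Lemma realizable_rand_computable (h : pboolfun Q) (v c : X -> R) (M : R) T :
    realizable v c ->
    (forall x b, h x = Some b ->
       (if b then 1 - v x else v x) <= 1 / 3%:R + 1 / 100%:R /\ c x <= M) ->
    40%:R * M <= T.+1%:R ->
  rand_computable R h (3 * T).
Proof.
move=> [A AE] hv MT.
have [B [BE Belt]] := findist_of (fun j => dt_trunc T (fd_elt (f := A) j))
  (@fd_weight_ge0 _ _ A) (fd_weight_sum1 A).
apply: (rand_computable_majority (A := B)).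
  apply: (Belt (fun d => (dt_depth d <= T)%N)) => j.
  exact: dt_trunc_depth.
move=> x b hx; have [vx cx] := hv _ _ hx; have [ve ce] := AE x.
have -> : rand_error B x b =
    fd_mean A (fun d => (dt_eval x (dt_trunc T d) != b)%:R).
  exact: (etrans (BE (fun d => (dt_eval x d != b)%:R))).
pose err d : R := (dt_eval x d != b)%:R.
have errE : fd_mean A err = if b then 1 - v x else v x.
  rewrite -ve /err; case: b {hx vx err}.
    rewrite -[X in X - _](fd_mean_cst A 1) -mulN1r -fd_meanZ -fd_meanD.
    by apply: eq_bigr => j _; case: (dt_eval _ _) => /=; congr (_ * _); ring.
  by apply: eq_bigr => j _; case: (dt_eval _ _).
(* Markov's inequality in pointwise form: a run that is cut has a count of at least [T + 1]. *)
apply: (@le_trans _ _ (fd_mean A (fun d => err d + T.+1%:R^-1 * (dt_count x d)%:R))).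
  apply: fd_mean_le => j; case: (leqP (dt_count x (fd_elt j)) T) => jT.
    by rewrite dt_trunc_eval // lerDl mulr_ge0 ?invr_ge0.
  apply: (@le_trans _ _ 1); first by rewrite lern1 leq_b1.
  apply: ler_wpDl; first by rewrite ler0n.
  by rewrite mulrC ler_pdivlMr ?ltr0n // mul1r ler_nat.
rewrite fd_meanD fd_meanZ errE ce.
have : T.+1%:R^-1 * c x <= 1 / 40%:R.
  rewrite mulrC ler_pdivrMr ?ltr0n // mulrC mul1r ler_pdivlMr ?ltr0n //.
  by rewrite mulrC; apply: le_trans MT; rewrite ler_pM2l ?ltr0n.
by move: (_ * c x) (if b then _ else _) vx => u w; lra.
Qed.

End Simulation.

(** * Finite runs of noisy algorithms *)

Section NoisyRuns.
Variables (R : realType) (I : finType).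
Implicit Types (A : nalgo R I) (b : {ffun I -> bool}) (phi : naction R I -> R).

Definition outputs (c : bool) (d : naction R I) : R := (naction_outputs c d)%:R.

(** Expected total of [phi] over at most [N] actions after the history [s]; it serves for output
    probabilities and for costs. Answer probabilities vanish after an output, which ends the run. *)
Fixpoint run_total phi A b (N : nat) (s : seq bool) : R :=
  match N with
  | 0 => 0
  | N'.+1 => phi (A s) +
      \sum_r nanswer_prob b (A s) r * run_total phi A b N' (rcons s r)
  end.

End NoisyRuns.

(** * Noisy access to the blocks *)

Section NoisyBlocks.
Variables (R : realType) (I J : finType) (g0 : R).
Hypotheses (J0 : (0 < #|J|)%N) (g0_gt0 : 0 < g0) (g0_lt1 : g0 < 1).
Local Notation X := {ffun I * J -> bool}.

Definition sgb (b : bool) : R := if b then 1 else -1.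

Lemma sgb_cases b : sgb b = 1 \/ sgb b = -1.
Proof. by case: b; [left|right]. Qed.

(** A majority is defined on every input, so no partial value has to be carried along. *)
Definition block_bits (x : X) : {ffun I -> bool} :=
  [ffun i => (#|J| < 2 * count (fun j => x (i, j)) (enum J))%N].

(** Equivalently, a uniformly random bit of a block is a noisy copy of the bit of that block with
    parameter [g0]. *)
Definition balanced (x : X) : Prop := forall i,
  \sum_j (x (i, j))%:R = #|J|%:R * ((1 + sgb (block_bits x i) * g0) / 2%:R) :> R.

(** Mean over the answer to a noisy call on [b], with value [u] after the answer 1 and [v] after the
    answer 0. *)
Definition noisy_mix (b : bool) (g u v : R) : R :=
  (1 + sgb b * g) / 2%:R * u + (1 - sgb b * g) / 2%:R * v.

Lemma noisy_mix_le b g u v u' v' : -1 <= g <= 1 -> u <= u' -> v <= v' ->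
  noisy_mix b g u v <= noisy_mix b g u' v'.
Proof.
move=> /andP[gN g1] uu vv; rewrite /noisy_mix.
by apply: lerD; apply: ler_wpM2l => //; case: (sgb_cases b) => ->; lra.
Qed.

Lemma noisy_mix_cst b g r : noisy_mix b g r r = r.
Proof. by rewrite /noisy_mix; field. Qed.

(** Continuation form of a noisy call: whatever follows the two answers, the call can be placed in
    front for [k] more expected queries. *)
Definition simulable (i : I) (g k : R) : Prop :=
  forall v1 c1 v0 c0 : X -> R, realizable v1 c1 -> realizable v0 c0 ->
  exists v c, realizable v c /\ forall x, balanced x ->
    v x = noisy_mix (block_bits x i) g (v1 x) (v0 x) /\
    c x <= k + noisy_mix (block_bits x i) g (c1 x) (c0 x).

Lemma simulable_le i g k k' : k <= k' -> simulable i g k -> simulable i g k'.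
Proof.
move=> kk gk v1 c1 v0 c0 h1 h0; have [v [c [vc vcE]]] := gk _ _ _ _ h1 h0.
exists v, c; split=> // x /vcE[-> cx]; split=> //.
by apply: le_trans cx _; rewrite lerD2r.
Qed.

(** The answer is kept with probability [(1 + g' / g) / 2] and negated otherwise; this covers
    negative [g'] as well. *)
Lemma simulable_garble i g g' k : `|g'| <= g -> simulable i g k -> simulable i g' k.
Proof.
move=> g'g gk v1 c1 v0 c0 h1 h0.
have [g00|gn0] := eqVneq g 0.
  have g'0 : g' = 0 by apply/eqP; rewrite -normr_le0 -g00.
  by rewrite g'0 -g00; apply: gk.
have gp : 0 < g by rewrite lt_neqAle eq_sym gn0 (le_trans _ g'g).
pose p := (1 + g' / g) / 2%:R.
have p01 : 0 <= p <= 1.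
  have : `|g' / g| <= 1 by rewrite normrM normfV (gtr0_norm gp) ler_pdivrMr ?mul1r.
  by rewrite ler_norml /p => /andP[a b]; apply/andP; split; lra.
have [v [c [vc vcE]]] := gk _ _ _ _
  (realizable_mix p01 h1 h0) (realizable_mix p01 h0 h1).
exists v, c; split=> // x /vcE[-> cx]; split.
  by rewrite /noisy_mix /p; field; rewrite gn0.
apply: le_trans cx _; rewrite lerD2l le_eqVlt; apply/orP; left; apply/eqP.
by rewrite /noisy_mix /p; field; rewrite gn0.
Qed.

Lemma simulable_sample i : simulable i g0 1.
Proof.
move=> v1 c1 v0 c0 h1 h0.
have Jn0 : #|J|%:R != 0 :> R by rewrite pnatr_eq0 -lt0n.
pose w (j : J) : R := #|J|%:R^-1.
have w0 j : 0 <= w j by rewrite invr_ge0.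
have w1 : \sum_j w j = 1 by rewrite sumr_const -[_ *+ _]mulr_natr mulVf.
have avg x (a b : R) : balanced x ->
    \sum_j w j * (if x (i, j) then a else b) = noisy_mix (block_bits x i) g0 a b.
  move=> xb; rewrite -mulr_sumr.
  have -> : \sum_j (if x (i, j) then a else b) =
      \sum_j ((x (i, j))%:R * (a - b) + b).
    by apply: eq_bigr => j _; case: (x _); rewrite ?mul1r ?mul0r ?add0r ?subrK.
  rewrite big_split /= -mulr_suml xb sumr_const -[b *+ _]mulr_natr /noisy_mix.
  by rewrite cardT -cardE; field.
have h j := realizable_query (i, j) h1 h0.
do 2!eexists; split; first exact: (realizable_mixture w0 w1 h).
move=> x xb; split; first exact: avg.
rewrite -avg // le_eqVlt; apply/orP; left; apply/eqP.
by rewrite -[X in X + _]w1 -big_split; apply: eq_bigr => j _; rewrite mulrDr mulr1.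
Qed.

(** Reading the block reveals its bit, and a private coin then produces the noisy answer. *)
Lemma simulable_block i g : -1 <= g <= 1 -> simulable i g #|J|%:R.
Proof.
move=> /andP[gN g1] v1 c1 v0 c0 h1 h0.
pose bit (r : seq bool) := (#|J| < 2 * count id r)%N.
pose p b := (1 + sgb b * g) / 2%:R.
have p01 b : 0 <= p b <= 1.
  by rewrite /p; apply/andP; case: (sgb_cases b) => ->; split; lra.
have h r := realizable_mix (p01 (bit r)) h1 h0.
do 2!eexists; split.
  exact: (realizable_query_all [seq (i, j) | j <- enum J] h).
move=> x xb; rewrite size_map -cardE /=.
have -> : bit [seq x q | q <- [seq (i, j) | j <- enum J]] = block_bits x i.
  by rewrite ffunE /bit -map_comp count_map.
split; first by rewrite /noisy_mix /p; field.
rewrite lerD2l le_eqVlt; apply/orP; left; apply/eqP.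
by rewrite /noisy_mix /p; field.
Qed.

(** * Amplification by a stopped random walk *)

(* Bias of the bit obtained from a walk with steps +-1 of mean [g], started at
   [s], stopped after [m] steps or when it may leave [-L, L], by outputting 1
   with probability (1 + position / L) / 2. *)
Fixpoint walk_bias (L g : R) (m : nat) (s : R) : R :=
  match m with
  | 0 => s / L
  | m'.+1 => if `|s| > L - 1 then s / L else
      (1 + g) / 2%:R * walk_bias L g m' (s + 1)
      + (1 - g) / 2%:R * walk_bias L g m' (s - 1)
  end.

Lemma walk_biasN (L g : R) m (s : R) : walk_bias L (- g) m (- s) = - walk_bias L g m s.
Proof.
elim: m s => [|m IH] s /=; first by rewrite mulNr.
rewrite normrN; case: ifP => _; first by rewrite mulNr.
have -> : - s + 1 = - (s - 1) by ring.
by rewrite -opprD !IH; field.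
Qed.

(* The walk has drift [g], and by optional stopping for its square it rarely
   stops early. *)
Lemma walk_bias_ge (L g : R) m (s : R) : 1 < L -> 0 <= g <= 1 -> `|s| <= L ->
  s / L + g * m%:R / L * (1 - (s ^+ 2 + m%:R * (1 + 2%:R * (L - 1) * g)) / (L - 1) ^+ 2)
    <= walk_bias L g m s.
Proof.
move=> L1 /andP[g0' g1']; have Lp : 0 < L by lra.
have L2 : 0 < (L - 1) ^+ 2 by rewrite exprn_gt0 ?subr_gt0.
elim: m s => [|m IH] s sL /=; first by rewrite mulr0 !mul0r addr0.
set c := 1 + 2%:R * (L - 1) * g; set m1 : R := m.+1%:R.
have c0 : 0 <= c by rewrite addr_ge0 ?mulr_ge0 ?subr_ge0 // ltW.
have m1E : m1 = m%:R + 1 by rewrite /m1 -natr1.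
have m0 : 0 <= m%:R :> R by [].
case: ifPn => [sL1|].
  (* At a stopped position [s^2 >= (L - 1)^2], so the correction term is nonpositive. *)
  rewrite gerDl mulr_ge0_le0 //; first by rewrite !mulr_ge0 ?invr_ge0 // ltW.
  rewrite subr_le0 ler_pdivlMr // mul1r ler_wpDr ?mulr_ge0 //.
  by rewrite -(real_normK (num_real s)) ler_sqr ?nnegrE ?subr_ge0 ?(ltW L1) ?(ltW sL1).
rewrite -leNgt => sL1.
move: (sL1); rewrite ler_norml => /andP[s1 s2].
have hp : `|s + 1| <= L by rewrite ler_norml; apply/andP; split; lra.
have hm : `|s - 1| <= L by rewrite ler_norml; apply/andP; split; lra.
have gp : 0 <= (1 + g) / 2%:R by lra.
have gm : 0 <= (1 - g) / 2%:R by lra.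
apply: le_trans (lerD (ler_wpM2l gp (IH _ hp)) (ler_wpM2l gm (IH _ hm))).
(* The square of the position grows in mean by [1 + 2 g s], which is at most [c] because the walk
   moves only while [|s| <= L - 1]. *)
have key : g * s <= g * (L - 1) by rewrite ler_wpM2l.
rewrite -subr_ge0 -/c.
pose Y := (s ^+ 2 + m1 * c) / (L - 1) ^+ 2.
have -> : (1 + g) / 2%:R * ((s + 1) / L + g * m%:R / L *
      (1 - ((s + 1) ^+ 2 + m%:R * c) / (L - 1) ^+ 2)) +
    (1 - g) / 2%:R * ((s - 1) / L + g * m%:R / L *
      (1 - ((s - 1) ^+ 2 + m%:R * c) / (L - 1) ^+ 2)) -
    (s / L + g * m1 / L * (1 - (s ^+ 2 + m1 * c) / (L - 1) ^+ 2)) =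
    g / L * Y + g * m%:R / L * (2%:R * (g * (L - 1) - g * s)) / (L - 1) ^+ 2.
  by rewrite /Y m1E /c; field; rewrite (gt_eqF Lp) (gt_eqF (_ : 0 < L - 1)) // subr_gt0.
have Y0 : 0 <= Y.
  by rewrite divr_ge0 ?(ltW L2) // addr_ge0 ?sqr_ge0 ?mulr_ge0 // /m1 ler0n.
have gL : 0 <= g / L by rewrite divr_ge0 // ltW.
clearbody Y.
by rewrite addr_ge0 ?mulr_ge0 ?invr_ge0 ?subr_ge0 ?(ltW Lp) ?(ltW L2).
Qed.

(** The bit of the block enters only through the sign of the drift in [w], hence the mixture with
    [true]. *)
Lemma realizable_walk i (L : R) m (s : R) (v1 c1 v0 c0 : X -> R) :
    1 < L -> `|s| <= L -> realizable v1 c1 -> realizable v0 c0 ->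
  exists v c, realizable v c /\ forall x, balanced x ->
    let w := walk_bias L (sgb (block_bits x i) * g0) m s in
    v x = noisy_mix true w (v1 x) (v0 x) /\
    c x <= m%:R + noisy_mix true w (c1 x) (c0 x).
Proof.
move=> L1 sL h1 h0; have Lp := lt_trans ltr01 L1.
have stop (r : R) : `|r| <= L -> exists v c, realizable v c /\ forall x,
    v x = noisy_mix true (r / L) (v1 x) (v0 x) /\
    c x = noisy_mix true (r / L) (c1 x) (c0 x).
  move=> rL; have p01 : 0 <= (1 + r / L) / 2%:R <= 1.
    have : `|r / L| <= 1 by rewrite normrM normfV (gtr0_norm Lp) ler_pdivrMr ?mul1r.
    by rewrite ler_norml => /andP[a b]; apply/andP; split; lra.
  do 2!eexists; split; first exact: (realizable_mix p01 h1 h0).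
  by move=> x; rewrite /noisy_mix !mul1r; split; field; rewrite gt_eqF.
elim: m s sL => [|m IH] s sL /=.
  have [v [c [vc vcE]]] := stop s sL.
  by exists v, c; split=> // x _; have [-> ->] := vcE x; rewrite add0r.
have [sL1|] := ltP (L - 1) `|s|.
  have [v [c [vc vcE]]] := stop s sL.
  by exists v, c; split=> // x _; have [-> ->] := vcE x; rewrite lerDr.
rewrite ler_norml => /andP[s1 s2].
have hp : `|s + 1| <= L by rewrite ler_norml; apply/andP; split; lra.
have hm : `|s - 1| <= L by rewrite ler_norml; apply/andP; split; lra.
have [vp [cp [hvp vpE]]] := IH _ hp; have [vm [cm [hvm vmE]]] := IH _ hm.
have [v [c [vc vcE]]] := simulable_sample i hvp hvm.
exists v, c; split=> // x xb; have [-> cx] := vcE x xb.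
have [-> cpx] := vpE x xb; have [-> cmx] := vmE x xb.
split; first by rewrite /noisy_mix; field.
have g01 : -1 <= g0 <= 1 by move: g0_gt0 g0_lt1 => gp g1; apply/andP; split; lra.
apply: le_trans cx (le_trans (lerD (lexx 1) (noisy_mix_le _ g01 cpx cmx)) _).
by rewrite -natr1 le_eqVlt; apply/orP; left; apply/eqP; rewrite /noisy_mix; field.
Qed.

Lemma simulable_walk i (L : R) m : 1 < L ->
  simulable i (walk_bias L g0 m 0) m%:R.
Proof.
move=> L1 v1 c1 v0 c0 h1 h0.
have L0 : `|0 : R| <= L by rewrite normr0; lra.
have [v [c [vc vcE]]] := realizable_walk i m L1 L0 h1 h0.
exists v, c; split=> // x /vcE.
have -> : walk_bias L (sgb (block_bits x i) * g0) m 0 =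
    sgb (block_bits x i) * walk_bias L g0 m 0.
  case: (sgb_cases (block_bits x i)) => ->; rewrite ?mul1r //.
  by rewrite !mulN1r -[X in walk_bias _ _ _ X]oppr0 walk_biasN.
by rewrite /noisy_mix !mul1r.
Qed.

(** With [K] about [6 |g| / g0], a walk of [K^2] steps and barrier [2 K + 1] has bias at least
    [g0 K / 6 >= |g|], which is then garbled to [g]. *)
Lemma simulable_amplify i (g : R) : g0 / 4%:R <= `|g| <= 1 / 40%:R ->
  simulable i g (100%:R * g ^+ 2 / g0 ^+ 2).
Proof.
move=> /andP[gl gu]; have gp := g0_gt0; set u := `|g| / g0.
have u4 : 1 / 4%:R <= u by rewrite /u ler_pdivlMr // mulrC mul1r mulrC; lra.
have ug : u * g0 = `|g| by rewrite /u divfK // gt_eqF.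
pose k := (Num.trunc (6%:R * u)).+1.
have /andP[k1 k2] : (k.-1)%:R <= 6%:R * u < k%:R by rewrite truncn_itv //; lra.
have kE : k%:R = k.-1%:R + 1 :> R by rewrite natr1.
have kp : 1 <= k%:R :> R by rewrite ler1n.
(* The bound [u >= 1/4] absorbs the rounding: [6 u + 1 <= 10 u]. *)
have {}k1 : k%:R <= 10%:R * u by lra.
set K : R := k%:R in kp k1 k2 kE; pose L := 2%:R * K + 1.
have L1 : 1 < L by rewrite /L; lra.
apply: (@simulable_le i g (k ^ 2)%:R).
  rewrite -(real_normK (num_real g)) -mulrA -expr_div_n -/u.
  have -> : 100%:R * u ^+ 2 = (10%:R * u) ^+ 2 by ring.
  by rewrite natrX ler_sqr ?nnegrE //; lra.
apply: simulable_garble (simulable_walk i (k ^ 2) L1).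
have g01 : 0 <= g0 <= 1 by rewrite !ltW.
have L0 : `|0 : R| <= L by rewrite normr0; lra.
apply: le_trans (walk_bias_ge (k ^ 2) L1 g01 L0).
rewrite mul0r add0r natrX -/K expr0n add0r.
have -> : 1 - K ^+ 2 * (1 + 2%:R * (L - 1) * g0) / (L - 1) ^+ 2 =
    (3%:R - 4%:R * (K * g0)) / 4%:R.
  by rewrite /L; field; rewrite gt_eqF //; lra.
have Kg : K * g0 <= 10%:R * `|g| by rewrite -ug mulrA ler_wpM2r //; lra.
rewrite -ug; apply: (@le_trans _ _ (K / 6%:R * g0)); first by rewrite ler_wpM2r //; lra.
have -> : g0 * K ^+ 2 / L * ((3%:R - 4%:R * (K * g0)) / 4%:R) =
    (K ^+ 2 / L * (3%:R - 4%:R * (K * g0)) / 4%:R) * g0.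
  by field; rewrite gt_eqF //; lra.
rewrite ler_wpM2r //; first lra.
have KL : K / 3%:R <= K ^+ 2 / L.
  by rewrite ler_pdivlMr /L; nra.
(* The second factor is at least 2 because [K g0 <= 10 |g| <= 1/4]. *)
have : K / 3%:R * 2%:R <= K ^+ 2 / L * (3%:R - 4%:R * (K * g0)).
  by apply: ler_pM => //; lra.
lra.
Qed.

(** * Hidden samples and Bayesian updates *)

(* Law of the hidden sample given the bit [b] and the posterior bias [y]. *)
Definition belief (b : bool) (y : R) (h : bool) : R :=
  (1 + sgb b * sgb h * g0) * (1 + sgb h * y / g0) / (2%:R * (1 + sgb b * y)).

(* Bayes' update of the posterior bias by an answer 1 of parameter [g]; an answer
   0 has parameter [- g]. *)
Definition vadd (y g : R) : R := (y + g) / (1 + y * g).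

(** Given [h], the past answers have likelihood proportional to [1 + sgb h * y / g0]. Hence the
    answer 1 has probability [(1 + y g) (1 + sgb h * y' / g0) / (2 (1 + sgb h * y / g0))] with
    [y' = vadd y g], here simplified. If the denominator is 0 the value is 1/2. *)
Definition answer_given (y g : R) (h : bool) : R :=
  (1 + g * ((y * g0 + sgb h) / (g0 + sgb h * y))) / 2%:R.

Lemma lt1_abs (y : R) : `|y| <= g0 -> -1 < y /\ y < 1.
Proof. by rewrite ler_norml => /andP[a b]; move: g0_lt1 => c; split; lra. Qed.

Lemma belief_den_gt0 b y : `|y| <= g0 -> 0 < 1 + sgb b * y.
Proof. by move=> /lt1_abs[a c]; case: (sgb_cases b) => ->; lra. Qed.

Lemma belief_num_ge0 (y : R) h : `|y| <= g0 -> 0 <= 1 + sgb h * y / g0.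
Proof.
move=> yg; have : `|y / g0| <= 1.
  by rewrite normrM normfV (gtr0_norm g0_gt0) ler_pdivrMr ?mul1r.
by rewrite ler_norml -mulrA => /andP[a c]; case: (sgb_cases h) => ->; lra.
Qed.

Lemma belief_ge0 b y h : `|y| <= g0 -> 0 <= belief b y h.
Proof.
move=> yg; rewrite /belief divr_ge0 ?mulr_ge0 ?belief_num_ge0 ?(ltW (belief_den_gt0 _ _)) //.
by move: g0_gt0 g0_lt1 => g0p g01; case: (sgb_cases b) => ->; case: (sgb_cases h) => ->; lra.
Qed.

Lemma belief_sum b y : `|y| <= g0 -> \sum_h belief b y h = 1.
Proof.
move=> yg; have := belief_den_gt0 b yg; rewrite big_bool /belief /= => /gt_eqF d.
have s2 : sgb b * sgb b = 1 by case: (sgb_cases b) => ->; rewrite ?mulrNN mulr1.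
have g0n : g0 != 0 by rewrite gt_eqF.
have e : (1 + sgb b * 1 * g0) * (1 + 1 * y / g0) + (1 + sgb b * -1 * g0) * (1 + -1 * y / g0)
   = 2%:R * (1 + sgb b * y) by field.
by rewrite -mulrDl e divff // mulf_neq0 ?d // pnatr_eq0.
Qed.

Lemma belief0 b h : belief b 0 h = (1 + sgb b * sgb h * g0) / 2%:R.
Proof. by rewrite /belief !mulr0 mul0r !addr0 !mulr1. Qed.

Lemma answer_givenN y g h : answer_given y (- g) h = 1 - answer_given y g h.
Proof. by rewrite /answer_given mulNr; move: (g * _) => u; field. Qed.

(* Bayes' rule: given [h], the answers do not depend on [b]. *)
Lemma belief_answer b y g h :
    `|y| <= g0 -> -1 < g < 1 -> `|vadd y g| <= g0 -> `|vadd y (- g)| <= g0 ->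
  belief b y h * answer_given y g h =
  (1 + sgb b * g) / 2%:R * belief b (vadd y g) h.
Proof.
move=> yg /andP[gN g1] hp hm.
have g0n : g0 != 0 by rewrite gt_eqF.
have [y1 y2] := lt1_abs yg.
have dp : 0 < 1 + y * g by nra.
have dm : 0 < 1 - y * g by nra.
have d := gt_eqF (belief_den_gt0 b yg).
have d' := gt_eqF (belief_den_gt0 b hp).
have [z|nz] := eqVneq (g0 + sgb h * y) 0; last first.
  rewrite /belief /answer_given.
  have -> : 1 + sgb h * vadd y g / g0 = (g0 * (1 + y * g) + sgb h * (y + g)) / (g0 * (1 + y * g)).
    by rewrite /vadd; field; rewrite g0n gt_eqF.
  have e : 1 + sgb b * vadd y g = (1 + sgb b * g) * (1 + sgb b * y) / (1 + y * g).
    by rewrite /vadd; case: (sgb_cases b) => ->; field; rewrite gt_eqF.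
  have bg : 1 + sgb b * g != 0 by case: (sgb_cases b) => ->; rewrite gt_eqF //; lra.
  rewrite e; case: (sgb_cases h) nz => -> nz; field;
    by rewrite ?g0n ?d ?bg ?nz ?(gt_eqF dp) //; move: nz; rewrite ?mul1r ?mulN1r => ->.
have zy : 1 + sgb h * y / g0 = 0.
  by rewrite -[1](divff g0n) -mulrDl z mul0r.
rewrite /belief zy mulr0 !mul0r.
(* Here [h] already has probability 0. The nonnegative weights after the two answers add up to this
   zero, so both vanish. *)
have : (1 + y * g) * (1 + sgb h * vadd y g / g0)
     + (1 - y * g) * (1 + sgb h * vadd y (- g) / g0) = 0.
  transitivity (2%:R * (1 + sgb h * y / g0)); last by rewrite zy mulr0.
  by rewrite /vadd; field; rewrite g0n !gt_eqF // mulrN.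
move/eqP; rewrite paddr_eq0 ?mulr_ge0 ?belief_num_ge0 ?(ltW dp) ?(ltW dm) //.
by rewrite mulf_eq0 (gt_eqF dp) /= => /andP[/eqP -> _]; rewrite mulr0 mul0r mulr0.
Qed.

(** Bayes' rule writes a positive multiple of this number as a nonnegative one as long as the
    updated bias stays in [[-g0, g0]]; exchanging [g] and [- g] gives the upper bound. *)
Lemma answer_given_itv y g h :
    `|y| <= g0 -> -1 < g < 1 -> `|vadd y g| <= g0 -> `|vadd y (- g)| <= g0 ->
  0 <= answer_given y g h <= 1.
Proof.
have half (g' : R) : `|y| <= g0 -> -1 < g' < 1 -> `|vadd y g'| <= g0 ->
    `|vadd y (- g')| <= g0 -> 0 <= answer_given y g' h.
  move=> yg g'1 hp hm.
  have := belief_answer true h yg g'1 hp hm.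
  have [z|nz] := eqVneq (g0 + sgb h * y) 0.
    by move=> _; rewrite /answer_given z invr0 !mulr0 addr0 divr_ge0.
  have b0 : 0 < belief true y h.
    rewrite lt_neqAle belief_ge0 // andbT eq_sym /belief.
    have := gt_eqF (belief_den_gt0 true yg) => d.
    have e : 1 + sgb h * y / g0 = (g0 + sgb h * y) / g0.
      by rewrite mulrDl divff ?gt_eqF.
    rewrite e !mulf_neq0 ?invr_eq0 ?nz ?mulf_neq0 ?d ?pnatr_eq0 ?(gt_eqF g0_gt0) //.
    move: g0_gt0 g0_lt1 => g0p g01.
    by case: (sgb_cases h) => ->; rewrite gt_eqF //= ; lra.
  move=> e; rewrite -(pmulr_rge0 _ b0) e mulr_ge0 ?belief_ge0 //=.
  by move: g'1 => /andP[? ?]; lra.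
move=> yg g1 hp hm; rewrite half //= -subr_ge0 -answer_givenN half ?opprK //.
by move: g1 => /andP[a c]; apply/andP; split; lra.
Qed.

Definition upd (y : I -> R) (i : I) (r : R) : I -> R :=
  fun j => if j == i then r else y j.

Definition switch (h : {ffun I -> bool}) (i : I) (c : bool) : {ffun I -> bool} :=
  [ffun j => if j == i then c else h j].

(** Given the bits [b], the hidden samples of different blocks are independent. *)
Definition belief_mean (b : {ffun I -> bool}) (y : I -> R)
    (F : {ffun I -> bool} -> R) : R :=
  \sum_(h : {ffun I -> bool}) (\prod_j belief (b j) (y j) (h j)) * F h.

Lemma upd_le y i r : (forall j, `|y j| <= g0) -> `|r| <= g0 ->
  forall j, `|upd y i r j| <= g0.
Proof. by move=> yg rg j; rewrite /upd; case: (j == i). Qed.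

Lemma belief_mean_cst b y r : (forall j, `|y j| <= g0) ->
  belief_mean b y (fun=> r) = r.
Proof.
move=> yg; rewrite /belief_mean -mulr_suml.
rewrite -(bigA_distr_bigA (fun j c => belief (b j) (y j) c)) /=.
by rewrite big1 ?mul1r // => j _; rewrite belief_sum.
Qed.

Lemma belief_meanD b y F G :
  belief_mean b y (fun h => F h + G h) = belief_mean b y F + belief_mean b y G.
Proof. by rewrite -big_split; apply: eq_bigr => h _; rewrite mulrDr. Qed.

Lemma belief_meanZ b y r F :
  belief_mean b y (fun h => r * F h) = r * belief_mean b y F.
Proof. by rewrite /belief_mean mulr_sumr; apply: eq_bigr => h _; rewrite mulrCA. Qed.

Lemma belief_mean_mix b y c g F G :
  belief_mean b y (fun h => noisy_mix c g (F h) (G h)) =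
  noisy_mix c g (belief_mean b y F) (belief_mean b y G).
Proof. by rewrite /noisy_mix belief_meanD !belief_meanZ. Qed.

Lemma belief_mean_le b y F G : (forall j, `|y j| <= g0) ->
  (forall h, F h <= G h) -> belief_mean b y F <= belief_mean b y G.
Proof.
move=> yg FG; apply: ler_sum => h _; apply: ler_wpM2l => //.
by apply: prodr_ge0 => j _; apply: belief_ge0.
Qed.

(** Drawing the answer from the hidden sample gives it the law of a noisy answer, and conditioning
    on it updates the bias of block [i] only. *)
Lemma belief_mean_answer b y i g F :
    (forall j, `|y j| <= g0) -> -1 < g < 1 ->
    `|vadd (y i) g| <= g0 -> `|vadd (y i) (- g)| <= g0 ->
  belief_mean b y (fun h => answer_given (y i) g (h i) * F h) =
  (1 + sgb (b i) * g) / 2%:R * belief_mean b (upd y i (vadd (y i) g)) F.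
Proof.
move=> yg g1 hp hm; rewrite /belief_mean mulr_sumr; apply: eq_bigr => h _.
rewrite [in LHS](bigD1 i) //= [in RHS](bigD1 i) //=.
have -> : \prod_(j | j != i) belief (b j) (upd y i (vadd (y i) g) j) (h j) =
    \prod_(j | j != i) belief (b j) (y j) (h j).
  by apply: eq_bigr => j /negbTE ji; rewrite /upd ji.
have -> : upd y i (vadd (y i) g) i = vadd (y i) g by rewrite /upd eqxx.
have e := belief_answer (b i) (h i) (yg i) g1 hp hm.
by rewrite mulrACA e; ring.
Qed.

(** Flipping coordinate [i] is an involution; the identity isolates one coordinate without changing
    the index type. *)
Lemma sum_switch (G : {ffun I -> bool} -> R) i :
  \sum_h \sum_c G (switch h i c) = 2%:R * \sum_h G h.
Proof.
have flipK : involutive (fun h => switch h i (~~ h i)).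
  by move=> h; apply/ffunP => j; rewrite !ffunE eqxx; case: eqVneq => // ->; rewrite negbK.
have sw h : switch h i (h i) = h.
  by apply/ffunP => j; rewrite ffunE; case: eqVneq => // ->.
transitivity (\sum_h (G h + G (switch h i (~~ h i)))).
  apply: eq_bigr => h _; rewrite big_bool /=.
  have -> : G h = G (switch h i (h i)) by rewrite sw.
  by case: (h i); rewrite //= addrC.
rewrite big_split /= -[X in _ + X](reindex_inj (F := G) (P := fun=> true) (inv_inj flipK)).
by rewrite mulrDl mul1r.
Qed.

(** The old sample sums out to 1, and the law of a fresh one is the belief of bias 0. *)
Lemma belief_mean_resample b y i F : (forall j, `|y j| <= g0) ->
  belief_mean b y (fun h =>
    noisy_mix (b i) g0 (F (switch h i true)) (F (switch h i false))) =
  belief_mean b (upd y i 0) F.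
Proof.
move=> yg; have two : 2%:R != 0 :> R by rewrite pnatr_eq0.
apply: (mulfI two); rewrite -!(sum_switch _ i).
apply: eq_bigr => h _; pose P := \prod_(j | j != i) belief (b j) (y j) (h j).
have LE c : \prod_j belief (b j) (y j) (switch h i c j) = belief (b i) (y i) c * P.
  rewrite (bigD1 i) //= ffunE eqxx; congr (_ * _).
  by apply: eq_bigr => j /negbTE ji; rewrite ffunE ji.
have RE c : \prod_j belief (b j) (upd y i 0 j) (switch h i c j) = belief (b i) 0 c * P.
  rewrite (bigD1 i) //= ffunE /upd eqxx; congr (_ * _).
  by apply: eq_bigr => j /negbTE ji; rewrite ffunE ji.
have sw c d : switch (switch h i c) i d = switch h i d.
  by apply/ffunP => j; rewrite !ffunE; case: (j == i).
have := belief_sum (b i) (yg i); rewrite !big_bool /= => e.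
rewrite !LE !RE !sw -mulrDl -mulrDl e mul1r !belief0 /noisy_mix.
by rewrite (_ : sgb true = 1) // (_ : sgb false = -1) //; ring.
Qed.

(** * Emulation of noisy calls *)

(* The simulation starts with a hidden sample [h i] for each block, whose law
   given the bits of the blocks is determined by the posterior bias [y i]. *)
Definition emulable (y : I -> R) (v c : {ffun I -> bool} -> R) : Prop :=
  exists V C : {ffun I -> bool} -> X -> R,
    (forall h, realizable (V h) (C h)) /\
    forall x, balanced x ->
      belief_mean (block_bits x) y (V^~ x) = v (block_bits x) /\
      belief_mean (block_bits x) y (C^~ x) <= c (block_bits x).

Lemma emulable_le y v c c' : (forall b, c b <= c' b) ->
  emulable y v c -> emulable y v c'.
Proof.
move=> cc [V [C [VC E]]]; exists V, C; split=> // x /E[-> Cx]; split=> //.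
exact: le_trans Cx _.
Qed.

Lemma emulable_output y (r : bool) : (forall j, `|y j| <= g0) ->
  emulable y (fun=> r%:R) (fun=> 0).
Proof.
move=> yg; exists (fun _ _ => r%:R), (fun _ _ => 0); split.
  by move=> _; apply: realizable_leaf.
by move=> x _; rewrite !belief_mean_cst.
Qed.

(** A call answered by fresh queries leaves the hidden samples, and so [y], unchanged. *)
Lemma emulable_simulable y i g k v1 c1 v0 c0 :
    (forall j, `|y j| <= g0) -> -1 <= g <= 1 -> simulable i g k ->
    emulable y v1 c1 -> emulable y v0 c0 ->
  emulable y (fun b => noisy_mix (b i) g (v1 b) (v0 b))
             (fun b => k + noisy_mix (b i) g (c1 b) (c0 b)).
Proof.
move=> yg g1 gk [V1 [C1 [VC1 E1]]] [V0 [C0 [VC0 E0]]].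
have [V HV] := choice (fun h => gk _ _ _ _ (VC1 h) (VC0 h)).
have [C HC] := choice HV.
exists V, C; split=> [h|x xb]; first by have [] := HC h.
have [v1E c1E] := E1 x xb; have [v0E c0E] := E0 x xb.
split.
  rewrite -v1E -v0E -belief_mean_mix; apply: eq_bigr => h _.
  by have [_ /(_ x xb)[-> _]] := HC h.
apply: le_trans (lerD (lexx k) (noisy_mix_le _ g1 c1E c0E)).
rewrite -belief_mean_mix -[X in X + _](belief_mean_cst (block_bits x) k yg) -belief_meanD.
by apply: belief_mean_le => // h; have [_ /(_ x xb)[_]] := HC h.
Qed.

Lemma emulable_resample y i v c : (forall j, `|y j| <= g0) ->
  emulable (upd y i 0) v c -> emulable y v (fun b => 1 + c b).
Proof.
move=> yg [V0 [C0 [VC0 E0]]].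
have [V HV] := choice (fun h =>
  simulable_sample i (VC0 (switch h i true)) (VC0 (switch h i false))).
have [C HC] := choice HV.
exists V, C; split=> [h|x xb]; first by have [] := HC h.
have [v0E c0E] := E0 x xb; split.
  rewrite -v0E -belief_mean_resample //; apply: eq_bigr => h _.
  by have [_ /(_ x xb)[-> _]] := HC h.
apply: le_trans (lerD (lexx 1) c0E).
rewrite -belief_mean_resample // -[X in X + _](belief_mean_cst (block_bits x) 1 yg).
rewrite -belief_meanD.
by apply: belief_mean_le => // h; have [_ /(_ x xb)[_]] := HC h.
Qed.

(** The answer is drawn from the hidden sample with private randomness, at no query. *)
Lemma emulable_small y i g v1 c1 v0 c0 :
    (forall j, `|y j| <= g0) -> -1 < g < 1 ->
    `|vadd (y i) g| <= g0 -> `|vadd (y i) (- g)| <= g0 ->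
    emulable (upd y i (vadd (y i) g)) v1 c1 ->
    emulable (upd y i (vadd (y i) (- g))) v0 c0 ->
  emulable y (fun b => noisy_mix (b i) g (v1 b) (v0 b))
             (fun b => noisy_mix (b i) g (c1 b) (c0 b)).
Proof.
move=> yg g1 hp hm [V1 [C1 [VC1 E1]]] [V0 [C0 [VC0 E0]]].
have Ng1 : -1 < - g < 1 by move: g1 => /andP[a c]; apply/andP; split; lra.
pose p (h : {ffun I -> bool}) := answer_given (y i) g (h i).
exists (fun h x => p h * V1 h x + (1 - p h) * V0 h x).
exists (fun h x => p h * C1 h x + (1 - p h) * C0 h x); split=> [h|x xb].
  by apply: realizable_mix => //; apply: answer_given_itv.
have E b F G : belief_mean b y (fun h => p h * F h + (1 - p h) * G h) =
    noisy_mix (b i) g (belief_mean b (upd y i (vadd (y i) g)) F)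
                      (belief_mean b (upd y i (vadd (y i) (- g))) G).
  rewrite belief_meanD belief_mean_answer //; congr (_ + _).
  rewrite -mulrN -belief_mean_answer ?opprK //.
  by apply: eq_bigr => h _; rewrite answer_givenN.
have [v1E c1E] := E1 x xb; have [v0E c0E] := E0 x xb.
rewrite !E v1E v0E; split=> //.
by apply: noisy_mix_le => //; move: g1 => /andP[a c]; rewrite !ltW.
Qed.

(** Since [vadd y g = y + g (1 - y^2) / (1 + y g)], the cross terms of the two squares nearly cancel
    and have mean [2 q g^2] with [q <= 2]; the remaining squares add at most [2 g^2]. This holds for
    each value of the bit. *)
Lemma vadd_sqr_mean b (y g : R) : `|y| <= g0 -> `|g| <= 1 / 4%:R ->
  noisy_mix b g (vadd y g ^+ 2) (vadd y (- g) ^+ 2) <= y ^+ 2 + 8%:R * g ^+ 2.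
Proof.
move=> /lt1_abs[y1 y2]; rewrite ler_norml => /andP[ga gb].
have y20 : 0 <= y ^+ 2 <= 1 by rewrite sqr_ge0 /=; nra.
have g20 : 0 <= g ^+ 2 <= 1 / 16%:R by rewrite sqr_ge0 /=; nra.
have dp : 3%:R / 4%:R <= 1 + y * g by nra.
have dm : 3%:R / 4%:R <= 1 - y * g by nra.
have sq (d : R) : 3%:R / 4%:R <= d -> ((1 - y ^+ 2) / d) ^+ 2 <= 2%:R.
  move=> hd; rewrite expr_div_n ler_pdivrMr; last by rewrite exprn_gt0 //; lra.
  have : (1 - y ^+ 2) ^+ 2 <= 1 by nra.
  have : 9%:R / 16%:R <= d ^+ 2 by nra.
  lra.
have dd : 0 < 1 - y ^+ 2 * g ^+ 2 by nra.
have dd2 : 1 / 2%:R <= 1 - y ^+ 2 * g ^+ 2 by nra.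
set e := sgb b; set q := y * ((1 - y ^+ 2) * (e - y) / (1 - y ^+ 2 * g ^+ 2)).
have q3 : q <= 2%:R.
  rewrite /q mulrA ler_pdivrMr //.
  have : y * ((1 - y ^+ 2) * (e - y)) <= 1; last lra.
  have ey : y * (e - y) <= 1 by rewrite /e; case: (sgb_cases b) => ->; nra.
  rewrite mulrCA; nra.
have -> : noisy_mix b g (vadd y g ^+ 2) (vadd y (- g) ^+ 2) =
    y ^+ 2 + g ^+ 2 * (2%:R * q + noisy_mix b g (((1 - y ^+ 2) / (1 + y * g)) ^+ 2)
                                        (((1 - y ^+ 2) / (1 - y * g)) ^+ 2)).
  have dE : 1 - y ^+ 2 * g ^+ 2 = (1 + y * g) * (1 - y * g) by ring.
  have [dpn dmn] : 1 + y * g != 0 /\ 1 - y * g != 0 by split; rewrite gt_eqF //; lra.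
  have e2 : e = 1 \/ e = -1 by exact: sgb_cases.
  by rewrite /q dE /noisy_mix /vadd -/e mulrN; case: e2 => ->; field; rewrite dpn dmn.
rewrite lerD2l mulrC ler_wpM2r //; first by case/andP: g20.
have g1 : -1 <= g <= 1 by apply/andP; split; lra.
have := noisy_mix_le b g1 (sq _ dp) (sq _ dm).
rewrite noisy_mix_cst; lra.
Qed.

(** Hence a call with [|g| <= g0 / 4] forces a new sample only when [|y| > g0 / 2]. *)
Lemma vadd_le_half y g : `|y| <= g0 / 2%:R -> `|g| <= g0 / 4%:R -> `|vadd y g| <= g0.
Proof.
move: g0_gt0 g0_lt1 => g0p g01.
rewrite !ler_norml /vadd => /andP[y1 y2] /andP[a b].
have d : 7%:R / 8%:R <= 1 + y * g by nra.
have dp : 0 < 1 + y * g by lra.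
by rewrite ler_pdivlMr // ler_pdivrMr //; apply/andP; split; nra.
Qed.

Lemma run_total_query (phi : naction R I -> R) (A : nalgo R I) b N s i g :
  A s = NQuery i g -> run_total phi A b N.+1 s =
  phi (NQuery i g) + noisy_mix (b i) g (run_total phi A b N (rcons s true))
                                       (run_total phi A b N (rcons s false)).
Proof.
move=> As; rewrite /= As big_bool /= /noisy_mix; congr (_ + _).
by case: (b i); rewrite /= ?mul1r ?mulN1r ?opprK.
Qed.

Lemma run_total_output (phi : naction R I -> R) (A : nalgo R I) b N s r :
  A s = NOutput R I r -> run_total phi A b N.+1 s = phi (NOutput R I r).
Proof. by move=> As; rewrite /= As big1 ?addr0 // => c _; rewrite mul0r. Qed.

(** * The potential argument *)

Hypothesis J_le : #|J|%:R * g0 ^+ 2 <= 16%:R.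

(** The value [160^2 = 16 * 40^2] pays for reading a block; amplification needs only 100 and the
    growth of the potential only 32. *)
Let K : R := 160%:R ^+ 2 / g0 ^+ 2.
(** The factor makes a term exceed 1 once [|y j| > g0 / 2], which pays for a new sample. *)
Let potential (y : I -> R) : R := \sum_j 4%:R / g0 ^+ 2 * y j ^+ 2.

Let potential_upd y i r :
  potential (upd y i r) = potential y + 4%:R / g0 ^+ 2 * (r ^+ 2 - y i ^+ 2).
Proof.
rewrite /potential (bigD1 i) //= [in RHS](bigD1 i) //= /upd eqxx.
rewrite (eq_bigr (fun j => 4%:R / g0 ^+ 2 * y j ^+ 2)); last first.
  by move=> j /negbTE ->.
ring.
Qed.

Let potential_ge0 y : 0 <= potential y.
Proof. by apply: sumr_ge0 => j _; rewrite mulr_ge0 ?divr_ge0 ?sqr_ge0. Qed.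

(** Induction on [N]: in mean, the queries made for a call plus the change of the potential are at
    most [K * g ^+ 2]. *)
Lemma emulable_run (A : nalgo R I) N s y :
    nalgo_valid A -> (forall j, `|y j| <= g0) ->
  emulable y
    (fun b => run_total (@outputs R I true) A b N s)
    (fun b => 160%:R ^+ 2 / g0 ^+ 2 * run_total (@naction_cost R I) A b N s +
              \sum_j 4%:R / g0 ^+ 2 * y j ^+ 2).
Proof.
move=> Av; rewrite -/K; have g02 : 0 < g0 ^+ 2 by rewrite exprn_gt0.
elim: N s y => [|N IH] s y yg; rewrite -/(potential y).
  apply: emulable_le (emulable_output false yg) => b /=.
  by rewrite mulr0 add0r; exact: potential_ge0.
case As : (A s) => [r|i g].
  rewrite (_ : (fun b => run_total _ A b N.+1 s) = fun=> (r == true)%:R); last first.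
    by apply/funext => b; rewrite (run_total_output _ _ _ As).
  apply: emulable_le (emulable_output _ yg) => b.
  by rewrite (run_total_output _ _ _ As) mulr0 add0r; exact: potential_ge0.
have g1 := Av _ _ _ As.
rewrite (_ : (fun b => run_total _ A b N.+1 s) = fun b => noisy_mix (b i) g
    (run_total (@outputs R I true) A b N (rcons s true))
    (run_total (@outputs R I true) A b N (rcons s false)));
  last by apply/funext => b; rewrite (run_total_query _ _ _ As) add0r.
set W := fun b r => run_total (@naction_cost R I) A b N (rcons s r).
have WE b : run_total (@naction_cost R I) A b N.+1 s =
    g ^+ 2 + noisy_mix (b i) g (W b true) (W b false).
  by rewrite (run_total_query _ _ _ As).
have mixE (b : {ffun I -> bool}) p q : noisy_mix (b i) g (K * W b true + p) (K * W b false + q) =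
    K * noisy_mix (b i) g (W b true) (W b false) + noisy_mix (b i) g p q.
  by rewrite /noisy_mix; ring.
have big k : simulable i g k -> k <= K * g ^+ 2 ->
    emulable y (fun b => noisy_mix (b i) g
      (run_total (@outputs R I true) A b N (rcons s true))
      (run_total (@outputs R I true) A b N (rcons s false)))
      (fun b => K * run_total (@naction_cost R I) A b N.+1 s + potential y).
  move=> gk kK; apply: emulable_le (emulable_simulable yg g1 gk
    (IH (rcons s true) y yg) (IH (rcons s false) y yg)) => b.
  by rewrite -!/(potential y) -!/(W b _) mixE noisy_mix_cst WE [K * (g ^+ 2 + _)]mulrDr -addrA lerD2r.
have [gbig|gsmall] := ltP (1 / 40%:R) `|g|.
  (* Here [K * g ^+ 2 >= 16 / g0 ^+ 2 >= #|J|]. *)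
  apply: big (simulable_block i g1) _.
  rewrite /K mulrAC ler_pdivlMr //.
  have : (1 / 40%:R) ^+ 2 <= `|g| ^+ 2 by rewrite ler_sqr ?nnegrE ?divr_ge0 ?(ltW gbig).
  rewrite real_normK ?num_real // => g2; apply: le_trans J_le _; lra.
have [gmid|gtiny] := leP (g0 / 4%:R) `|g|.
  apply: big (simulable_amplify i _) _; first by rewrite gmid gsmall.
  rewrite /K [leRHS]mulrAC ler_wpM2r ?invr_ge0 ?(ltW g02) //.
  rewrite ler_wpM2r ?sqr_ge0 //; lra.
have g14 : `|g| <= 1 / 4%:R by lra.
have g1' : -1 < g < 1.
  by move: gsmall; rewrite ler_norml => /andP[a c]; apply/andP; split; lra.
have tiny z : (forall j, `|z j| <= g0) -> `|vadd (z i) g| <= g0 ->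
    `|vadd (z i) (- g)| <= g0 ->
    emulable z (fun b => noisy_mix (b i) g
      (run_total (@outputs R I true) A b N (rcons s true))
      (run_total (@outputs R I true) A b N (rcons s false)))
      (fun b => K * run_total (@naction_cost R I) A b N.+1 s + potential z).
  move=> zg hp hm; apply: emulable_le (emulable_small zg g1' hp hm
    (IH (rcons s true) _ (upd_le i zg hp)) (IH (rcons s false) _ (upd_le i zg hm))) => b.
  rewrite -!/(potential _) -!/(W b _) mixE WE [K * (g ^+ 2 + _)]mulrDr addrAC [X in _ <= X]addrC.
  rewrite lerD2l !potential_upd.
  have -> : noisy_mix (b i) g
      (potential z + 4%:R / g0 ^+ 2 * (vadd (z i) g ^+ 2 - z i ^+ 2))
      (potential z + 4%:R / g0 ^+ 2 * (vadd (z i) (- g) ^+ 2 - z i ^+ 2)) =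
    potential z + 4%:R / g0 ^+ 2 * (noisy_mix (b i) g (vadd (z i) g ^+ 2)
      (vadd (z i) (- g) ^+ 2) - z i ^+ 2).
    by rewrite /noisy_mix; field; rewrite gt_eqF.
  rewrite [leRHS]addrC lerD2l /K mulrAC [leRHS]mulrAC ler_wpM2r ?invr_ge0 ?(ltW g02) //.
  (* The potential grows in mean by at most [(4 / g0^2) * 8 g^2]. *)
  have := vadd_sqr_mean (b i) (zg i) g14; have := sqr_ge0 g; lra.
have [hp|hp] := boolP ((`|vadd (y i) g| <= g0) && (`|vadd (y i) (- g)| <= g0)).
  by apply: tiny; case/andP: hp.
have yi : g0 / 2%:R < `|y i|.
  rewrite ltNge; apply: contra hp => yi.
  by rewrite !vadd_le_half // ?normrN ltW.
have v0 g' : vadd 0 g' = g' by rewrite /vadd mul0r addr0 add0r divr1.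
have g00 : `|0 : R| <= g0 by rewrite normr0 ltW.
have gg0 : `|g| <= g0 by move: g0_gt0 => g0p; lra.
(* The bias is reset to 0 and the call is answered from the new sample; the drop of the potential by
   at least 1 pays for the query. *)
have := emulable_resample yg (tiny (upd y i 0) (upd_le i yg g00) _ _).
rewrite {1 2}/upd eqxx !v0 normrN => /(_ gg0 gg0); apply: emulable_le => b.
rewrite potential_upd expr0n sub0r mulrN addrCA lerD2l.
rewrite addrCA gerDl subr_le0 mulrAC ler_pdivlMr // mul1r.
have : (g0 / 2%:R) ^+ 2 <= `|y i| ^+ 2.
  by rewrite ler_sqr ?nnegrE ?divr_ge0 ?(ltW yi) // ltW.
by rewrite real_normK ?num_real //; lra.
Qed.

(** The additive term is the initial potential, 4 for each block. *)
Lemma realizable_run (A : nalgo R I) N : nalgo_valid A ->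
  exists v c, realizable v c /\ forall x, balanced x ->
    let b := block_bits x in
    v x = run_total (@outputs R I true) A b N [::] /\
    c x <= 160%:R ^+ 2 / g0 ^+ 2 * run_total (@naction_cost R I) A b N [::]
           + 4%:R * #|I|%:R.
Proof.
move=> Av; have yg (j : I) : `|g0| <= g0 by rewrite ger0_norm // ltW.
have [V [C [VC E]]] := emulable_run N [::] Av yg.
(* Initially [y = g0], as if the sample 1 had just been revealed: the next call
   of nonzero parameter resamples. *)
pose h0 : {ffun I -> bool} := [ffun=> true].
have mean b F : belief_mean b (fun=> g0) F = F h0.
  have g0n : g0 != 0 by rewrite gt_eqF.
  rewrite /belief_mean (bigD1 h0) //= big1 ?mul1r; last first.
    move=> j _; rewrite ffunE /belief (_ : sgb true = 1) // mulr1 !mul1r divff // -[1 + 1]/(2%:R).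
    rewrite [_ * 2%:R]mulrC divff // mulf_neq0 ?pnatr_eq0 //.
    by rewrite (gt_eqF (belief_den_gt0 _ (yg j))).
  rewrite big1 ?addr0 // => h hN.
  have /existsP[j /negbTE hj] : [exists j, ~~ h j].
    rewrite -negb_forall; apply: contra hN => /forallP hT.
    by apply/eqP/ffunP => j; rewrite ffunE hT.
  rewrite (bigD1 j) //= hj /belief (_ : sgb false = -1) // mulN1r mulNr divff // subrr mulr0 !mul0r //.
exists (V h0), (C h0); split=> // x xb /=; have := E x xb; rewrite !mean => -[-> Cx].
split=> //; apply: le_trans Cx _.
rewrite lerD2l divfK ?gt_eqF ?exprn_gt0 // sumr_const mulr_natr //.
Qed.

End NoisyBlocks.

(** * Truncation of noisy algorithms *)

Section NoisySeries.
Variables (R : realType) (I : finType).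
Implicit Types (a : nalgo R I) (b : {ffun I -> bool}) (phi : naction R I -> R).

Lemma sum_tuple_cons (T : finType) k (F : seq T -> R) :
  \sum_(u : k.+1.-tuple T) F u = \sum_r \sum_(u : k.-tuple T) F (r :: u).
Proof.
rewrite pair_bigA /= (reindex (fun p : T * k.-tuple T => [tuple of p.1 :: p.2])) //=.
exists (fun u : k.+1.-tuple T => (thead u, [tuple of behead u])) => [[r u] _|u _] /=.
  by rewrite theadE; congr (_, _); apply: val_inj.
by rewrite -tuple_eta.
Qed.

(** Unrolling the recursion gives the sum over answer strings by which output probabilities and
    costs are defined. *)
Lemma run_totalE phi a b N s :
  run_total phi a b N s = \sum_(k < N) \sum_(u : k.-tuple bool)
    (\prod_(j < k) nanswer_prob b (a (s ++ take j u)) (nth false u j))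
      * phi (a (s ++ u)).
Proof.
elim: N s => [|N IH] s; first by rewrite big_ord0.
rewrite big_ord_recl /=; congr (_ + _).
  rewrite (big_pred1 [tuple]) => [|u]; last by rewrite [u]tuple0.
  by rewrite big_ord0 mul1r cats0.
under [RHS]eq_bigr => k _.
  rewrite /bump /= add1n (sum_tuple_cons k (fun u => (\prod_(j < k.+1)
    nanswer_prob b (a (s ++ take j u)) (nth false u j)) * phi (a (s ++ u)))).
  over.
rewrite exchange_big /=; apply: eq_bigr => r _.
rewrite IH mulr_sumr; apply: eq_bigr => k _.
rewrite mulr_sumr; apply: eq_bigr => u _.
rewrite big_ord_recl /= cats0 cat_rcons mulrA; congr (_ * _ * _).
by apply: eq_bigr => j _; rewrite cat_rcons.
Qed.

Lemma partial_sum_run phi a b N :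
  (\sum_(0 <= k < N) \sum_(u : k.-tuple bool) (nreach a b u * phi (a u))%:E)%E =
  (run_total phi a b N [::])%:E.
Proof.
rewrite big_mkord run_totalE -sumEFin; apply: eq_bigr => k _.
rewrite -sumEFin; apply: eq_bigr => u _.
by rewrite /nreach size_tuple.
Qed.

Lemma nanswer_prob_ge0 a b s r : nalgo_valid a -> 0 <= nanswer_prob b (a s) r.
Proof.
move=> av; case E : (a s) => [//|i g] /=; have /andP[? ?] := av _ _ _ E.
by case: ifP => _; lra.
Qed.

Lemma run_term_ge0 phi a b k (u : k.-tuple bool) : nalgo_valid a ->
  (forall c, 0 <= phi c) -> (0 <= (nreach a b u * phi (a u))%:E)%E.
Proof.
move=> av phi0; rewrite lee_fin mulr_ge0 //.
by apply: prodr_ge0 => j _; apply: nanswer_prob_ge0.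
Qed.

Lemma run_total_ge0 phi a b N s : nalgo_valid a -> (forall c, 0 <= phi c) ->
  0 <= run_total phi a b N s.
Proof.
move=> av phi0; elim: N s => [|N IH] s //=; rewrite addr_ge0 ?sumr_ge0 // => r _.
by rewrite mulr_ge0 // nanswer_prob_ge0.
Qed.

(** A run outputs at most once, and the answers to a query have total probability 1. *)
Lemma run_outputs_le1 a b N s : nalgo_valid a ->
  run_total (outputs true) a b N s + run_total (outputs false) a b N s <= 1.
Proof.
move=> av; elim: N s => [|N IH] s /=; first by rewrite addr0 ler01.
rewrite addrACA -big_split /=.
have -> : \sum_r (nanswer_prob b (a s) r * run_total (outputs true) a b N (rcons s r)
    + nanswer_prob b (a s) r * run_total (outputs false) a b N (rcons s r)) =
  \sum_r nanswer_prob b (a s) r * (run_total (outputs true) a b N (rcons s r)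
    + run_total (outputs false) a b N (rcons s r)).
  by apply: eq_bigr => r _; rewrite mulrDr.
apply: (@le_trans _ _ (outputs true (a s) + outputs false (a s)
    + \sum_r nanswer_prob b (a s) r)).
  rewrite lerD2l; apply: ler_sum => r _.
  by rewrite ler_piMr // nanswer_prob_ge0.
rewrite big_bool /outputs; case: (a s) => [c|i g] /=; first by case: c => /=; lra.
by case: (b i) => /=; lra.
Qed.

(** The partial sums are nondecreasing and at most 1, so the limit is finite. Validity for all
    larger [M] lets one horizon serve several algorithms and inputs. *)
Lemma noutput_prob_approx a b c (e : R) : nalgo_valid a -> 0 < e ->
  exists N, forall M, (N <= M)%N ->
    (noutput_prob a b c <= (run_total (outputs c) a b M [::] + e)%:E)%E.
Proof.
move=> av e0; have out0 d : 0 <= outputs c d by rewrite ler0n.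
pose f k : \bar R := (\sum_(u : k.-tuple bool) (nreach a b u * outputs c (a u))%:E)%E.
have f0 k : (0 <= k)%N -> true -> (0 <= f k)%E.
  by move=> _ _; apply: sume_ge0 => u _; apply: run_term_ge0.
have SE N : (\sum_(0 <= k < N) f k)%E = (run_total (outputs c) a b N [::])%:E.
  exact: partial_sum_run.
rewrite -[noutput_prob a b c]/(\sum_(0 <= k <oo) f k)%E.
have cv := is_cvg_nneseries f0.
have le1 : (\sum_(0 <= k <oo) f k <= 1)%E.
  apply: lime_le => //; apply: nearW => N; rewrite SE lee_fin.
  have := run_outputs_le1 b N [::] av.
  have := run_total_ge0 b N [::] av (fun d => ler0n R (naction_outputs true d)).
  have := run_total_ge0 b N [::] av (fun d => ler0n R (naction_outputs false d)).
  by rewrite -!/(outputs _); case: (c); lra.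
have ge0 : (0 <= \sum_(0 <= k <oo) f k)%E by apply: nneseries_ge0 => k _; apply: f0.
set l := (\sum_(0 <= k <oo) f k)%E in le1 ge0 *.
have lfin : l \is a fin_num by rewrite ge0_fin_numE // (le_lt_trans le1) // ltry.
have le : ((fine l - e)%:E < l)%E by rewrite -[ltRHS](fineK lfin) lte_fin; lra.
have nd : {homo (fun N => \sum_(0 <= k < N) f k)%E : n m / (n <= m)%N >-> (n <= m)%E}.
  exact: ereal_nondecreasing_series.
have [N _ HN] := lte_lim nd cv le.
exists N => M NM; have := HN M NM; rewrite /= SE lee_fin => H.
by rewrite -(fineK lfin) lee_fin; lra.
Qed.

Lemma noisy_truncation (h : pboolfun I) (A : findist R (nalgo R I)) (e : R) :
    noisy_computes h A -> 0 < e ->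
  exists N, forall x (b : bool), h x = Some b ->
    2%:R / 3%:R - e <= fd_mean A (fun a => run_total (outputs b) a x N [::]).
Proof.
move=> [Av Ah] e0.
have [n nP] := choice (fun p : 'I_(fd_size A) * ({ffun I -> bool} * bool) =>
  noutput_prob_approx p.2.1 p.2.2 (Av p.1) e0).
exists (\max_p n p)%N => x b hx.
have := Ah _ _ hx; set N := (\max_p n p)%N => hp.
suff : ((2%:R / 3%:R)%:E <=
    (fd_mean A (fun a => run_total (outputs b) a x N [::] + e))%:E :> \bar R)%E.
  by rewrite lee_fin fd_meanD fd_mean_cst lerBlDr.
apply: le_trans hp _; rewrite /noisy_output_prob /fd_mean -sumEFin.
apply: lee_sum => j _; rewrite EFinM; apply: lee_wpmul2l.
  by rewrite lee_fin fd_weight_ge0.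
exact: (nP (j, (x, b))) (leq_bigmax (F := n) (j, (x, b))).
Qed.

Lemma fd_mean_cost_le (h : pboolfun I) (A : findist R (nalgo R I)) x N :
    (forall j, nalgo_valid (fd_elt (f := A) j)) -> isSome (h x) ->
  ((fd_mean A (fun a => run_total (@naction_cost R I) a x N [::]))%:E
     <= noisy_max_cost h A)%E.
Proof.
move=> Av hx; apply: (@le_trans _ _ (noisy_expected_cost A x)); last first.
  by apply: (le_bigmax_cond _ (P := fun x => isSome (h x))).
rewrite /noisy_expected_cost /fd_mean -sumEFin; apply: lee_sum => j _.
rewrite EFinM; apply: lee_wpmul2l; first by rewrite lee_fin fd_weight_ge0.
rewrite -partial_sum_run; apply: nneseries_lim_ge => k _ _.
apply: sume_ge0 => u _; apply: run_term_ge0 => // -[c|i g] //=.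
exact: sqr_ge0.
Qed.

End NoisySeries.

(** * Composition with GapMaj *)

Lemma Rquery_le (R : realType) (Q : finType) (h : pboolfun Q) T :
  rand_computable R h T -> (Rquery R h <= T)%N.
Proof.
by move=> hT; rewrite /Rquery; case: ex_minnP => m _; apply; apply/asboolP.
Qed.

(** Three runs, each cut after about [40 M] queries, give the factor 120. *)
Lemma Rquery_le_realizable (R : realType) (Q : finType) (h : pboolfun Q)
    (v c : {ffun Q -> bool} -> R) (M : R) :
    realizable v c -> 0 <= M ->
    (forall x b, h x = Some b ->
       (if b then 1 - v x else v x) <= 1 / 3%:R + 1 / 100%:R /\ c x <= M) ->
  (Rquery R h)%:R <= 120%:R * M.
Proof.
move=> vc M0 hv; pose T := Num.trunc (40%:R * M).
have M40 : 0 <= 40%:R * M by rewrite mulr_ge0.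
have /andP[T1 T2] : T%:R <= 40%:R * M < T.+1%:R by rewrite truncn_itv.
have := Rquery_le (realizable_rand_computable vc hv (ltW T2)).
rewrite -(ler_nat R) natrM => H; apply: le_trans H _; lra.
Qed.

Lemma Rquery_le_card (R : realType) (Q : finType) (h : pboolfun Q) :
  (Rquery R h)%:R <= 120%:R * #|Q|%:R :> R.
Proof.
pose v (r : seq bool) : bool := odflt false (h [ffun q => nth false r (index q (enum Q))]).
have vc := realizable_query_all (enum Q) (fun r => realizable_leaf R Q (v r)).
apply: (Rquery_le_realizable vc) => // x b hx; rewrite -cardE addr0; split=> //.
have -> : v [seq x q | q <- enum Q] = b.
  rewrite /v (_ : [ffun q => _] = x) ?hx //; apply/ffunP => q.
  by rewrite ffunE (nth_map q) ?nth_index ?index_mem ?mem_enum.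
by case: b {hx} => /=; lra.
Qed.

(** The parameter comes from [t/2 + 2 sqrt t = t (1 + 4 / sqrt t) / 2], and likewise with minus
    signs. *)
Lemma GapMaj_Some (R : realType) t (z : {ffun 'I_t -> bool}) (c : bool) :
    (16 < t)%N -> GapMaj R t z = Some c ->
  c = (t < 2 * #|[set j | z j]|)%N /\
  #|[set j | z j]|%:R = t%:R * ((1 + sgb R c * (4%:R / Num.sqrt t%:R)) / 2%:R) :> R.
Proof.
move=> t16 hz; pose w := #|[set j | z j]|; rewrite -/w.
set q := Num.sqrt t%:R : R.
have q2 : q ^+ 2 = t%:R by rewrite sqr_sqrtr.
have qp : 0 < q by rewrite sqrtr_gt0 ltr0n; apply: leq_trans t16.
have wE : w%:R = t%:R / 2%:R + sgb R c * (2%:R * q).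
  move: hz; rewrite /GapMaj -/w -/q; case: eqP => [-> [<-]|_].
    by rewrite mul1r.
  by case: eqP => // -> [<-]; rewrite mulN1r.
split; last by rewrite wE -q2; field; rewrite gt_eqF.
rewrite -(ltr_nat R) natrM wE.
by case: c {hz wE} => /=; [apply/esym | apply/esym/negbTE; rewrite -leNgt]; lra.
Qed.

Lemma pboolfun_comp_GapMaj (R : realType) n t (f : pboolfun 'I_n)
    (x : {ffun 'I_n * 'I_t -> bool}) b :
    (16 < t)%N -> pboolfun_comp f (GapMaj R t) x = Some b ->
  balanced (4%:R / Num.sqrt t%:R : R) x /\ f (block_bits x) = Some b.
Proof.
move=> t16; rewrite /pboolfun_comp; case: ifP => // /forallP hs hf.
pose z i : {ffun 'I_t -> bool} := [ffun j => x (i, j)].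
have zc i : exists c, GapMaj R t (z i) = Some c.
  by have := hs i; rewrite -/(z i); case: (GapMaj R t (z i)) => // c _; exists c.
have cnt i : count (fun j => x (i, j)) (enum 'I_t) = #|[set j | z i j]|.
  rewrite cardE size_filter enumT; apply: eq_in_count => j _ /=.
  by rewrite !inE ffunE.
have bitE i c : GapMaj R t (z i) = Some c -> block_bits x i = c.
  by move=> /(GapMaj_Some t16)[-> _]; rewrite ffunE cnt card_ord.
split=> [i|].
  have [c hc] := zc i; rewrite (bitE _ _ hc) card_ord.
  have [_ <-] := GapMaj_Some t16 hc.
  rewrite -sum1_card natr_sum [RHS]big_mkcond; apply: eq_bigr => j _.
  by rewrite inE ffunE; case: (x _).
rewrite -hf; congr f; apply/ffunP => i; rewrite [RHS]ffunE -/(z i).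
by have [c hc] := zc i; rewrite hc (bitE _ _ hc).
Qed.

(** With [g0 = 4 / sqrt t], the cost factor [160^2 / g0^2] becomes [40^2 t]. Truncating the noisy
    algorithm costs 1/100 of success probability. *)
Lemma Rquery_le_noisy (R : realType) n t (f : pboolfun 'I_n)
    (A : findist R (nalgo R 'I_n)) (M : R) :
    (16 < t)%N -> noisy_computes f A -> 0 <= M -> (noisy_max_cost f A <= M%:E)%E ->
  (Rquery R (pboolfun_comp f (GapMaj R t)))%:R <=
    120%:R * (40%:R ^+ 2 * t%:R * M + 4%:R * n%:R).
Proof.
move=> t16 hA M0 AM; have [Av _] := hA.
set q := Num.sqrt t%:R : R; pose g0 := 4%:R / q.
have q2 : q ^+ 2 = t%:R by rewrite sqr_sqrtr.
have q4 : 4%:R < q.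
  by rewrite -ltr_sqr ?nnegrE ?sqrtr_ge0 // q2 -natrX ltr_nat.
have qp : 0 < q by apply: lt_trans q4.
have g0_gt0 : 0 < g0 by rewrite divr_gt0.
have g0_lt1 : g0 < 1 by rewrite ltr_pdivrMr ?mul1r.
have J0 : (0 < #|'I_t|)%N by rewrite card_ord (leq_trans _ t16).
have J_le : #|'I_t|%:R * g0 ^+ 2 <= 16%:R.
  by rewrite card_ord -q2 /g0 le_eqVlt; apply/orP; left; apply/eqP; field; rewrite gt_eqF.
have e0 : 0 < 1 / 100%:R :> R by rewrite divr_gt0.
have [N hN] := noisy_truncation hA e0.
have [v hv] := choice (fun j => realizable_run J0 g0_gt0 g0_lt1 J_le N (Av j)).
have [c hvc] := choice hv.
have vc := realizable_mixture (@fd_weight_ge0 _ _ A) (fd_weight_sum1 A)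
  (fun j => (hvc j).1).
apply: (Rquery_le_realizable vc).
  by rewrite addr_ge0 ?mulr_ge0.
move=> x b hx; have [xb fx] := pboolfun_comp_GapMaj t16 hx.
have vE : \sum_j fd_weight j * v j x =
    fd_mean A (fun a => run_total (@outputs R 'I_n true) a (block_bits x) N [::]).
  by apply: eq_bigr => j _; have [-> _] := (hvc j).2 x xb.
split.
  rewrite vE; have := hN _ _ fx; case: b {hx fx} => hN'; first lra.
  (* For [b = false], acceptance is bounded through the probability of the output [false]; an
     unfinished run does not accept. *)
  have : fd_mean A (fun a => run_total (@outputs R 'I_n true) a (block_bits x) N [::])
    + fd_mean A (fun a => run_total (@outputs R 'I_n false) a (block_bits x) N [::]) <= 1.
    rewrite -fd_meanD -[leRHS](fd_mean_cst A 1); apply: fd_mean_le => j.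
    exact: run_outputs_le1.
  lra.
pose F a := run_total (@naction_cost R 'I_n) a (block_bits x) N [::].
apply: (@le_trans _ _ (fd_mean A (fun a => 160%:R ^+ 2 / g0 ^+ 2 * F a + 4%:R * n%:R))).
  apply: ler_sum => j _; apply: ler_wpM2l; first exact: fd_weight_ge0.
  by have [_] := (hvc j).2 x xb; rewrite card_ord.
rewrite fd_meanD fd_mean_cst fd_meanZ lerD2r.
have -> : 160%:R ^+ 2 / g0 ^+ 2 = 40%:R ^+ 2 * t%:R.
  by rewrite -q2 /g0; field; rewrite gt_eqF.
rewrite ler_wpM2l ?mulr_ge0 // -lee_fin.
by apply: le_trans AM; apply: fd_mean_cost_le; rewrite ?fx.
Qed.

Lemma noisyR_ge0 (R : realType) (I : finType) (h : pboolfun I) :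
  (0 <= noisyR R h)%E.
Proof.
apply: le_ereal_inf_tmp => _ [A _ <-]; exact: bigmax_ge_id.
Qed.

Theorem theorem2p4 (R : realType) :
  exists C : R, 0 < C /\
    forall (n t : nat) (f : pboolfun 'I_n), (1 <= t)%N ->
      ((Rquery R (pboolfun_comp f (GapMaj R t)))%:R%:E
         <= C%:E * (t%:R%:E * noisyR R f + n%:R%:E))%E.
Proof.
(* The summand [40^2] covers the noisy cost with its slack, and 4 the initial potential. *)
exists (120%:R * (40%:R ^+ 2 + 4%:R)); split; first by rewrite mulr_gt0 // addr_gt0.
move=> n t f t1; have n0 : 0 <= n%:R :> R by [].
have t0 : 0 < t%:R :> R by rewrite ltr0n.
have rfin : noisyR R f \is a fin_num.
  by rewrite ge0_fin_numE ?noisyR_ge0 // (le_lt_trans (noisyR_le_card R f)) // ltry.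
have := noisyR_ge0 R f; rewrite -(fineK rfin) lee_fin.
set r := fine _ => r0; have tr0 : 0 <= t%:R * r by rewrite mulr_ge0 // ltW.
rewrite -!(EFinM, EFinD) lee_fin.
have [|t16] := leqP t 16; last have [nz|n1] := posnP n.
- move=> t16; apply: le_trans (Rquery_le_card _ _) _.
  rewrite card_prod !card_ord natrM.
  have : n%:R * t%:R <= n%:R * 16%:R :> R by rewrite ler_wpM2l // ler_nat.
  move: (n%:R * t%:R) (t%:R * r) tr0 => u w w0 u0; lra.
(* For [n = 0] the slack [n / t] used below would be 0; there are no bits to query. *)
- apply: le_trans (Rquery_le_card _ _) _.
  rewrite card_prod !card_ord natrM.
  have -> : n%:R = 0 :> R by rewrite nz.
  by rewrite mul0r mulr0 addr0 !mulr_ge0 ?addr_ge0 // ltW.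
(* The infimum need not be attained; a slack of [n / t] contributes only [n] after multiplication by
   [t]. *)
- have d0 : 0 < n%:R / t%:R :> R by rewrite divr_gt0 // ltr0n.
  have [_ [A hA <-] AM] := lb_ereal_inf_adherent d0 rfin.
  have rd0 : 0 <= r + n%:R / t%:R by rewrite addr_ge0 // ltW.
  have {}AM : (noisy_max_cost f A <= (r + n%:R / t%:R)%:E)%E.
    by apply: ltW; rewrite EFinD /r fineK.
  apply: le_trans (Rquery_le_noisy t16 hA rd0 AM) _.
  have -> : 40%:R ^+ 2 * t%:R * (r + n%:R / t%:R) = 40%:R ^+ 2 * (t%:R * r + n%:R) :> R.
    by field; rewrite gt_eqF.
  move: (t%:R * r) tr0 => w w0; lra.
Qed.
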